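(* Let $\Theta$ be the decision set, $\Xi$ the sample space, $N$ the number of clients, $\rho>0$ a penalty coefficient, $\beta$ a scalar weight, $\Lambda=\{\lambda:\lambda_i\ge 0,\ \sum_{i=1}^N\lambda_i=1\}$, and let $\hat{\mathbb{P}}_1,\dots,\hat{\mathbb{P}}_N$ be the clients' empirical data distributions on $\Xi$, with $\hat{\mathbb{P}}_\lambda=\sum_{i=1}^N\lambda_i\hat{\mathbb{P}}_i$. Let $L(\theta,\xi)$, for $\theta\in\Theta$ and $\xi\in\Xi$, be the (outlier-penalized) loss function and $c(\xi,\zeta)$ a transportation cost on $\Xi\times\Xi$. Assume: (1) $L(\theta,\xi)$ is convex in $\theta$ for every $\xi\in\Xi$ and concave in $\xi$; (2) the domains are bounded: $\max_{\theta_1,\theta_2\in\Theta}\|\theta_1-\theta_2\|\le D_\theta$ and $\max_{\lambda_1,\lambda_2\in\Lambda}\|\lambda_1-\lambda_2\|\le D_\lambda$; (3) $|L(\theta,\xi)|\le B_1$ and $\|\nabla_\theta L(\theta,\xi)\|\le B_2$; (4) $c(\xi,\zeta)$ is strongly convex in $\xi$; (5) $\nabla_\theta L(\theta,\xi)$ is $L_{\theta\xi}$-Lipschitz continuous in $\xi$, and $L(\theta,\xi)-\rho c(\xi,\zeta)$ is differentiable and $L_\xi$-smooth in $\xi$ for every $\zeta\in\Xi$. Let $$H(\theta,\lambda)=\mathbb{E}_{\zeta\sim\hat{\mathbb{P}}_\lambda}\big[e^{f(\theta,\zeta)/(\rho\beta)}\big],\qquad f(\theta,\zeta)=\sup_{\xi\in\Xi}\{L(\theta,\xi)-\rho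 c(\xi,\zeta)\}.$$ Select the step sizes $\eta_\lambda=\eta_\theta=\frac{1}{\sqrt{T}}$. Then the DOR-FL algorithm (described in the context), run for $T$ steps with inner maximization accuracy $\epsilon$, satisfies $$\max_{\lambda\in\Lambda}H(\bar\theta,\lambda)-\min_{\theta\in\Theta}\max_{\lambda\in\Lambda}H(\theta,\lambda)=\mathcal{O}(T^{-1/2}+\epsilon),$$ where $\bar\theta=\frac1T\sum_{t=1}^T\theta_t$.
   Context: Setting: $L(\theta,\xi)=l(\theta,\xi)-h(\xi)$, where $l$ is a loss function and $h$ is an outlier scoring function that assigns larger values to samples suspected to be outliers; the server broadcasts $h$ to all clients. DOR-FL (Distributionally Outlier-Robust Federated Learning) algorithm, with iterates $\theta_t\in\Theta$ and $\lambda_t=(\lambda_{1,t},\dots,\lambda_{N,t})\in\Lambda$. For $t=1,\dots,T$: Each client $i=1,\dots,N$ draws a sample $\hat\zeta_{i,t}$ from $\hat{\mathbb{P}}_i$ and finds an $\epsilon$-approximate maximizer $z_{i,t}$ of $L(\theta_t,\xi)-\rho c(\xi,\hat\zeta_{i,t})$ over $\xi\in\Xi$, meaning $\mathrm{dist}(z_{i,t},X_{i,t}^* )\le\epsilon$, where $X_{i,t}^*$ is the set of exact maximizers and $\mathrm{dist}$ is the distance from a point to a set. The client computes $$g_{i,t}^{\theta}=\exp\Big(\frac{L(\theta_t,z_{i,t})-\rho c(z_{i,t},\hat\zeta_{i,t})}{\rho\beta}\Big)\frac{\nabla_\theta L(\theta_t,z_{i,t})}{\rho\beta},\qquad g_{i,t}^{\lambda}=\exp\Big(\frac{L(\theta_t,z_{i,t})-\rho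 c(z_{i,t},\hat\zeta_{i,t})}{\rho\beta}\Big),$$ sets $\theta_{i,t+1}=\theta_t-\eta_\theta g_{i,t}^{\theta}$, and sends $\theta_{i,t+1}$ and $g_{i,t}^{\lambda}$ to the server. The server updates $$\theta_{t+1}=\mathrm{Proj}_\Theta\Big(\sum_{i=1}^N\lambda_{i,t}\theta_{i,t+1}\Big),\qquad \lambda_{t+1}=\mathrm{Proj}_\Lambda\big(\lambda_t+\eta_\lambda g_t^{\lambda}\big),\qquad g_t^{\lambda}=(g_{1,t}^{\lambda},\dots,g_{N,t}^{\lambda}),$$ and broadcasts $(\theta_{t+1},\lambda_{t+1})$ to all clients. Here $\mathrm{Proj}_S$ denotes projection onto $S$, and $\eta_\theta,\eta_\lambda$ are the step sizes.
   Formalization: The formal theorem bounds the expectation over the algorithm's random draws of the max over λ of H at the averaged iterate, minus the min-max value (a bound for every sample path is false), and it assumes β > 0 (the claim fails for β < 0 and is undefined for β = 0). *)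

(* Defs.v *)
From HB Require Import structures.
From mathcomp Require Import all_boot all_order all_algebra.
From mathcomp Require Import all_classical all_reals all_analysis.

Set Implicit Arguments.
Unset Strict Implicit.
Unset Printing Implicit Defensive.

Import Order.TTheory GRing.Theory Num.Theory.
Import numFieldNormedType.Exports.

Local Open Scope classical_set_scope.
Local Open Scope ring_scope.

(* The library's norm on 'rV[R]_n is the sup norm, which induces the same
   topology and differentials; all distances, projections and Lipschitz bounds
   below are Euclidean. *)
Definition norm2 (R : realType) (n : nat) (u : 'rV[R]_n) : R :=
  Num.sqrt (\sum_(i < n) u 0 i ^+ 2).

Definition grad (R : realType) (n : nat) (f : 'rV[R]_n -> R) (x : 'rV[R]_n) :
    'rV[R]_n :=
  \row_(i < n) 'D_(delta_mx 0 i) (f : 'rV[R]_n -> R^o) x.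

Definition concave_function (R : realType) (n : nat) (D : set 'rV[R]_n)
    (f : 'rV[R]_n -> R) : Prop :=
  convex_function D (fun x => - f x).

Definition strongly_convex_function (R : realType) (n : nat)
    (D : set 'rV[R]_n) (f : 'rV[R]_n -> R) : Prop :=
  exists2 mu : R, 0 < mu &
    forall (x y : 'rV[R]_n) (t : R), D x -> D y -> 0 <= t <= 1 ->
      f (t *: x + (1 - t) *: y) <=
        t * f x + (1 - t) * f y - mu / 2 * t * (1 - t) * norm2 (x - y) ^+ 2.

Definition argmax_set (R : realType) (n : nat) (D : set 'rV[R]_n)
    (f : 'rV[R]_n -> R) : set 'rV[R]_n :=
  [set x | D x /\ forall y, D y -> f y <= f x].

(* Extended-real valued, so that the distance to the empty set is +oo. *)
Definition dist_to (R : realType) (n : nat) (x : 'rV[R]_n) (A : set 'rV[R]_n) :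
    \bar R :=
  ereal_inf [set (norm2 (x - y))%:E | y in A].

Definition is_proj (R : realType) (n : nat) (S : set 'rV[R]_n)
    (x y : 'rV[R]_n) : Prop :=
  S y /\ forall z, S z -> norm2 (x - y) <= norm2 (x - z).

Definition simplex (R : realType) (N : nat) : set 'rV[R]_N :=
  [set l | (forall i, 0 <= l 0 i) /\ \sum_(i < N) l 0 i = 1].
Arguments simplex R N : clear implicits.

(* Finitely supported distributions are represented by their point masses. The
   dataset s may contain repetitions. *)
Definition empirical (R : realType) (q : nat) (s : seq 'rV[R]_q)
    (x : 'rV[R]_q) : R :=
  (count_mem x s)%:R / (size s)%:R.

Definition mixture (R : realType) (q N : nat) (data : 'I_N -> seq 'rV[R]_q)
    (l : 'rV[R]_N) (x : 'rV[R]_q) : R :=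
  \sum_(i < N) l 0 i * empirical (data i) x.

Definition mean (R : realType) (q : nat) (m : 'rV[R]_q -> R)
    (g : 'rV[R]_q -> R) : R :=
  \sum_(x \in [set: 'rV[R]_q]) m x * g x.

Definition penalized (R : realType) (p q : nat)
    (L : 'rV[R]_p -> 'rV[R]_q -> R) (c : 'rV[R]_q -> 'rV[R]_q -> R) (rho : R)
    (theta : 'rV[R]_p) (zeta xi : 'rV[R]_q) : R :=
  L theta xi - rho * c xi zeta.

Definition robust_loss (R : realType) (p q : nat) (Xi : set 'rV[R]_q)
    (L : 'rV[R]_p -> 'rV[R]_q -> R) (c : 'rV[R]_q -> 'rV[R]_q -> R) (rho : R)
    (theta : 'rV[R]_p) (zeta : 'rV[R]_q) : R :=
  sup [set penalized L c rho theta zeta xi | xi in Xi].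

Definition objective (R : realType) (p q N : nat) (Xi : set 'rV[R]_q)
    (L : 'rV[R]_p -> 'rV[R]_q -> R) (c : 'rV[R]_q -> 'rV[R]_q -> R)
    (rho beta : R) (data : 'I_N -> seq 'rV[R]_q)
    (theta : 'rV[R]_p) (l : 'rV[R]_N) : R :=
  mean (mixture data l)
       (fun zeta => expR (robust_loss Xi L c rho theta zeta / (rho * beta))).

(* The maximum over the (compact) simplex of a function linear in l. *)
Definition worst_case (R : realType) (p q N : nat) (Xi : set 'rV[R]_q)
    (L : 'rV[R]_p -> 'rV[R]_q -> R) (c : 'rV[R]_q -> 'rV[R]_q -> R)
    (rho beta : R) (data : 'I_N -> seq 'rV[R]_q) (theta : 'rV[R]_p) : R :=
  sup [set objective Xi L c rho beta data theta l | l in simplex R N].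

Definition grad_lambda (R : realType) (p q : nat)
    (L : 'rV[R]_p -> 'rV[R]_q -> R) (c : 'rV[R]_q -> 'rV[R]_q -> R)
    (rho beta : R) (theta : 'rV[R]_p) (zeta z : 'rV[R]_q) : R :=
  expR (penalized L c rho theta zeta z / (rho * beta)).

Definition grad_theta (R : realType) (p q : nat)
    (L : 'rV[R]_p -> 'rV[R]_q -> R) (c : 'rV[R]_q -> 'rV[R]_q -> R)
    (rho beta : R) (theta : 'rV[R]_p) (zeta z : 'rV[R]_q) : 'rV[R]_p :=
  (grad_lambda L c rho beta theta zeta z / (rho * beta)) *:
    grad (fun th => L th z) theta.

Definition filtration (d : measure_display) (Omega : measurableType d)
    (F : nat -> set (set Omega)) : Prop :=
  [/\ forall t, sigma_algebra setT (F t),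
      forall t A, F t A -> measurable A &
      forall s t, (s <= t)%N -> F s `<=` F t].

(* Borel measurability with respect to the sub-sigma-algebra G. *)
Definition measurable_wrt (Omega : Type) (G : set (set Omega)) (R : realType)
    (n : nat) (X : Omega -> 'rV[R]_n) : Prop :=
  forall U : set 'rV[R]_n, open U -> G (X @^-1` U).

(* A run of T rounds of DOR-FL, indexed by t = 1, ..., T. The sigma-algebra
   F t is the information available at the beginning of round t: the sample
   zeta i t is a fresh draw from the empirical distribution of client i,
   independent of F t, and everything produced during round t belongs to
   F t.+1. The inner solver may be any (possibly randomized) method. *)
Record dorfl_run (R : realType) (p q N : nat)
    (Theta : set 'rV[R]_p) (Xi : set 'rV[R]_q)
    (L : 'rV[R]_p -> 'rV[R]_q -> R) (c : 'rV[R]_q -> 'rV[R]_q -> R)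
    (rho beta : R) (data : 'I_N -> seq 'rV[R]_q)
    (T : nat) (eps eta_theta eta_lambda : R)
    (d : measure_display) (Omega : measurableType d) (P : probability Omega R)
    (F : nat -> set (set Omega))
    (theta : nat -> Omega -> 'rV[R]_p) (lambda : nat -> Omega -> 'rV[R]_N)
    (zeta z : 'I_N -> nat -> Omega -> 'rV[R]_q) : Prop := {
  run_filtration : filtration F;
  run_theta_adapted : forall t, (1 <= t <= T)%N ->
    measurable_wrt (F t) (theta t);
  run_lambda_adapted : forall t, (1 <= t <= T)%N ->
    measurable_wrt (F t) (lambda t);
  run_zeta_adapted : forall i t, (1 <= t <= T)%N ->
    measurable_wrt (F t.+1) (zeta i t);
  run_z_adapted : forall i t, (1 <= t <= T)%N ->
    measurable_wrt (F t.+1) (z i t);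
  run_init : forall w, Theta (theta 1%N w) /\ simplex R N (lambda 1%N w);
  run_sample : forall i t w, (1 <= t <= T)%N -> zeta i t w \in data i;
  run_sample_law : forall i t x A, (1 <= t <= T)%N -> F t A ->
    P (A `&` zeta i t @^-1` [set x]) = (P A * (empirical (data i) x)%:E)%E;
  run_inner : forall i t w, (1 <= t <= T)%N ->
    Xi (z i t w) /\
    (dist_to (z i t w)
       (argmax_set Xi (penalized L c rho (theta t w) (zeta i t w)))
     <= eps%:E)%E;
  run_theta_step : forall t w, (1 <= t <= T)%N ->
    is_proj Theta
      (\sum_(i < N) lambda t w 0 i *:
         (theta t w - eta_theta *:
            grad_theta L c rho beta (theta t w) (zeta i t w) (z i t w)))
      (theta t.+1 w);
  run_lambda_step : forall t w, (1 <= t <= T)%N ->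
    is_proj (simplex R N)
      (lambda t w + eta_lambda *:
         \row_(i < N) grad_lambda L c rho beta (theta t w)
                        (zeta i t w) (z i t w))
      (lambda t.+1 w) }.

Definition average_iterate (R : realType) (p T : nat) (Omega : Type)
    (theta : nat -> Omega -> 'rV[R]_p) (w : Omega) : 'rV[R]_p :=
  T%:R^-1 *: \sum_(1 <= t < T.+1) theta t w.

(* Main.v *)
(** Fix the inner points z. Since exp((L(th,z) - rho c(z,zeta)) / (rho beta)) is convex
   in th and below exp(f(th,zeta) / (rho beta)), the client gradients are exact
   subgradients for the lower value g^lambda, so the two projected gradient steps give,
   for every outcome, a saddle-point regret of order sqrt T whose only error from the
   inner solver is exp(f / (rho beta)) - g^lambda = O(eps). That error is linear in eps
   because strong concavity confines the inner maximizers to a fixed ball and smoothness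
   bounds the slopes there.

   In expectation, the regret is evaluated against the sampled losses. Their deviations
   from the client means are bounded martingale differences, so the deviation accumulated
   by each client has second moment O(T), which handles the maximum over lambda; for the
   fixed comparator th, the deviation weighted by lambda_t has mean zero. Jensen's
   inequality passes to the averaged iterate. *)
Require Import Defs.
From HB Require Import structures.
From mathcomp Require Import all_boot all_order all_algebra.
From mathcomp Require Import all_classical all_reals all_analysis.
From mathcomp Require Import measurable_realfun.
From mathcomp Require Import ring lra.
Set Implicit Arguments.
Unset Strict Implicit.
Unset Printing Implicit Defensive.
Import Order.TTheory GRing.Theory Num.Theory.
Import numFieldNormedType.Exports.
Local Open Scope classical_set_scope.
Local Open Scope ring_scope.

(** Three obstacles shape the argument. First, [Xi] may be unbounded and so may the cost, so
    [penalized] has no a priori bound. But for a fixed data point the cost cancels between two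
    parameters [th], and the values then differ by at most [2 * |B1|]. One reference parameter,
    together with the strong concavity modulus of that data point, therefore controls all parameters
    at once; the data points are finite in number, so the constants can be added up. Second, the
    worst-case risk of the averaged iterate is not shown to be measurable. It is nonnegative and
    dominated, outcome by outcome, by a bounded measurable function, and only the expectation of the
    latter is computed. The inexact maximizers are eliminated before that point, so the remaining
    noise is that of the draws [zeta]. Third, a minimizer of the worst-case risk is not assumed to
    exist. The upper bound is proved against every comparator and then passed to the infimum; the
    lower bound holds because the averaged iterate lies in [Theta] for every outcome. *)

Definition dotv (R : realType) (n : nat) (u v : 'rV[R]_n) : R :=
  \sum_(i < n) u 0 i * v 0 i.

(** * Euclidean geometry and gradients *)

Section euclid.
Context (R : realType) (n : nat).
Implicit Types (u v w x y z : 'rV[R]_n) (a : R).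

Lemma dotvC u v : dotv u v = dotv v u.
Proof. by apply: eq_bigr => i _; rewrite mulrC. Qed.

Lemma dotvDl u v w : dotv (u + v) w = dotv u w + dotv v w.
Proof. by rewrite -big_split; apply: eq_bigr => i _; rewrite mxE mulrDl. Qed.

Lemma dotvZl a u v : dotv (a *: u) v = a * dotv u v.
Proof. by rewrite mulr_sumr; apply: eq_bigr => i _; rewrite mxE mulrA. Qed.

Lemma dotvNl u v : dotv (- u) v = - dotv u v.
Proof. by rewrite -scaleN1r dotvZl mulN1r. Qed.

Lemma dotvBl u v w : dotv (u - v) w = dotv u w - dotv v w.
Proof. by rewrite dotvDl dotvNl. Qed.

Lemma dotvDr u v w : dotv u (v + w) = dotv u v + dotv u w.
Proof. by rewrite !(dotvC u) dotvDl. Qed.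

Lemma dotvZr a u v : dotv u (a *: v) = a * dotv u v.
Proof. by rewrite !(dotvC u) dotvZl. Qed.

Lemma dotvNr u v : dotv u (- v) = - dotv u v.
Proof. by rewrite !(dotvC u) dotvNl. Qed.

Lemma dotvBr u v w : dotv u (v - w) = dotv u v - dotv u w.
Proof. by rewrite dotvDr dotvNr. Qed.

Lemma dotv_suml (I : Type) (r : seq I) (F : I -> 'rV[R]_n) v :
  dotv (\sum_(i <- r) F i) v = \sum_(i <- r) dotv (F i) v.
Proof.
elim/big_ind2 : _ => [|u1 a1 u2 a2 <- <-|//]; last exact: dotvDl.
by rewrite -(scale0r v) dotvZl mul0r.
Qed.

Lemma dotv_ge0 u : 0 <= dotv u u.
Proof. by apply: sumr_ge0 => i _; rewrite -expr2 sqr_ge0. Qed.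

Lemma dotv_sqrB u v : dotv (u - v) (u - v) = dotv u u - 2 * dotv u v + dotv v v.
Proof. by rewrite dotvBl !dotvBr (dotvC v u); ring. Qed.

Lemma norm2_ge0 u : 0 <= norm2 u.
Proof. exact: sqrtr_ge0. Qed.

Lemma norm2_sqr u : norm2 u ^+ 2 = dotv u u.
Proof.
rewrite sqr_sqrtr; first by apply: eq_bigr => i _; rewrite expr2.
by apply: sumr_ge0 => i _; rewrite sqr_ge0.
Qed.

Lemma norm2N u : norm2 (- u) = norm2 u.
Proof. by rewrite /norm2; congr Num.sqrt; apply: eq_bigr => i _; rewrite mxE sqrrN. Qed.

Lemma norm2C u v : norm2 (u - v) = norm2 (v - u).
Proof. by rewrite -norm2N opprB. Qed.

Lemma norm20 : norm2 (0 : 'rV[R]_n) = 0.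
Proof. by rewrite /norm2 big1 ?sqrtr0// => i _; rewrite mxE expr0n. Qed.

Lemma normr_coord_le_norm2 u i : `|u 0 i| <= norm2 u.
Proof.
rewrite -sqrtr_sqr ler_wsqrtr// (bigD1 i)//= lerDl.
by apply: sumr_ge0 => j _; rewrite sqr_ge0.
Qed.

Lemma cauchy_schwarz u v : dotv u v <= norm2 u * norm2 v.
Proof.
have [dv0|dv_gt0] := leP (dotv v v) 0.
  have v0 i : v 0 i = 0.
    apply/eqP; rewrite -normr_le0 (le_trans (normr_coord_le_norm2 _ _))//.
    rewrite -(@ler_pXn2r _ 2)// ?nnegrE ?norm2_ge0//.
    by rewrite norm2_sqr expr0n.
  rewrite {1}/dotv big1; last by move=> i _; rewrite v0 mulr0.
  by rewrite mulr_ge0// norm2_ge0.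
(* This vector is [dotv v v] times the component of [u] orthogonal to [v]; its squared norm is
   [dotv v v] times the Gram determinant. *)
have := dotv_ge0 (dotv v v *: u - dotv u v *: v).
rewrite !(dotvBl, dotvBr, dotvZl, dotvZr) (dotvC v u).
move=> h; have {}h : 0 <= dotv v v * (dotv u u * dotv v v - dotv u v ^+ 2).
  by apply: le_trans h _; rewrite le_eqVlt; apply/orP; left; apply/eqP; ring.
rewrite pmulr_rge0// subr_ge0 -!norm2_sqr -exprMn in h.
apply: le_trans (ler_norm _) _.
by rewrite -(@ler_pXn2r _ 2)// ?nnegrE ?mulr_ge0 ?norm2_ge0// real_normK ?num_real.
Qed.

Lemma norm2D u v : norm2 (u + v) <= norm2 u + norm2 v.
Proof.
rewrite -(@ler_pXn2r _ 2)// ?nnegrE ?addr_ge0 ?norm2_ge0//.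
rewrite sqrrD !norm2_sqr dotvDl !dotvDr (dotvC v u).
have := cauchy_schwarz u v; lra.
Qed.

Lemma norm2Z a u : norm2 (a *: u) = `|a| * norm2 u.
Proof.
apply/eqP; rewrite -(@eqrXn2 _ 2)// ?mulr_ge0 ?norm2_ge0//.
by rewrite exprMn !norm2_sqr dotvZl dotvZr mulrA real_normK ?num_real.
Qed.

Lemma norm2_sum (I : Type) (r : seq I) (F : I -> 'rV[R]_n) :
  norm2 (\sum_(i <- r) F i) <= \sum_(i <- r) norm2 (F i).
Proof.
elim/big_rec2 : _ => [|i a u _ le_ua]; first by rewrite norm20.
by rewrite (le_trans (norm2D _ _))// lerD2l.
Qed.

Lemma norm2_le_sum u : norm2 u <= \sum_(i < n) `|u 0 i|.
Proof.
rewrite {1}(row_sum_delta u) (le_trans (norm2_sum _ _))// ler_sum// => i _.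
rewrite norm2Z ler_piMr// /norm2 (bigD1 i)//= mxE !eqxx expr1n big1 ?addr0 ?sqrtr1//.
by move=> j ji; rewrite mxE (negbTE ji) andbF expr0n.
Qed.

Lemma continuous_norm2 : continuous (@norm2 R n).
Proof.
move=> u; apply: (@continuous_comp _ _ _ (fun u : 'rV[R]_n => \sum_(i < n) u 0 i ^+ 2)).
  apply: (@continuous_big _ _ _ _ predT); first exact: add_continuous.
  move=> i _ v; apply: (@continuous_comp _ _ _ (fun v : 'rV[R]_n => v 0 i) (fun r : R => r ^+ 2)).
    exact: coord_continuous.
  exact: exprn_continuous.
exact: sqrt_continuous.
Qed.

Lemma convex_set_conv (S : set 'rV[R]_n) x y t :
  convex_set S -> S x -> S y -> 0 <= t <= 1 -> S (t *: x + (1 - t) *: y).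
Proof.
move=> cS Sx Sy /andP[t0 t1].
by have /set_mem := cS x y (Itv01 t0 t1) (mem_set Sx) (mem_set Sy).
Qed.

Lemma convex_function_conv (S : set 'rV[R]_n) (f : 'rV[R]_n -> R) x y t :
  convex_function S f -> S x -> S y -> 0 <= t <= 1 ->
  f (t *: x + (1 - t) *: y) <= t * f x + (1 - t) * f y.
Proof.
move=> cf Sx Sy /andP[t0 t1].
exact: (cf (Itv01 t0 t1) x y (mem_set Sx) (mem_set Sy)).
Qed.

(** The weights are normalized inside the statement so that the induction hypothesis applies to the
    tail of the list, whose total weight is arbitrary. A tail of total weight zero contributes
    nothing, because all its weights vanish. *)
Lemma convex_set_sum (S : set 'rV[R]_n) (I : Type) (r : seq I) (l : I -> R)
    (F : I -> 'rV[R]_n) :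
  convex_set S -> (forall i, 0 <= l i) -> (forall i, S (F i)) ->
  0 < \sum_(i <- r) l i ->
  S ((\sum_(i <- r) l i)^-1 *: \sum_(i <- r) l i *: F i).
Proof.
move=> cS l0 SF; elim: r => [|i r IH]; first by rewrite big_nil ltxx.
rewrite !big_cons; set s := \sum_(_ <- r) _ in IH *.
have s0 : 0 <= s by exact: sumr_ge0.
have [sp _|s_le0 linv_rho_beta_gt0] := ltP 0 s.
  have ls : 0 < l i + s by rewrite ltr_wpDl.
  have := @convex_set_conv S (F i) _ (l i / (l i + s)) cS (SF i) (IH sp).
  rewrite divr_ge0 ?ler_pdivrMr ?mul1r ?lerDl ?(ltW ls) ?s0// => /(_ isT).
  rewrite scalerDr !scalerA [_^-1 * l i]mulrC.
  rewrite (_ : (1 - l i / (l i + s)) / s = (l i + s)^-1)//.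
  by field; rewrite !gt_eqF.
have s_eq0 : s = 0 by apply/eqP; rewrite eq_le s_le0.
have -> : \sum_(j <- r) l j *: F j = 0.
  move: s_eq0; rewrite /s; elim: r {s IH s0 s_le0 linv_rho_beta_gt0} => [|j r IH].
    by rewrite !big_nil.
  rewrite !big_cons => /eqP; rewrite paddr_eq0// ?sumr_ge0// => /andP[/eqP -> /eqP].
  by move=> /IH ->; rewrite scale0r addr0.
move: linv_rho_beta_gt0; rewrite s_eq0 !addr0 => li.
by rewrite scalerA mulVf ?gt_eqF// scale1r.
Qed.

Lemma convex_set_average (S : set 'rV[R]_n) (x : nat -> 'rV[R]_n) T :
  convex_set S -> (0 < T)%N -> (forall t, (1 <= t <= T)%N -> S (x t)) ->
  S (T%:R^-1 *: \sum_(1 <= t < T.+1) x t).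
Proof.
move=> cS T0 Sx; rewrite big_add1 big_mkord.
have := @convex_set_sum S _ (index_enum 'I_T) (fun=> 1) (fun i => x i.+1) cS (fun=> ler01).
rewrite sumr_const card_ord; under eq_bigr do rewrite scale1r.
by apply; rewrite ?ltr0n// => i; apply: Sx; rewrite /= ltn_ord.
Qed.

(** Minimality of [y] along the segment towards [z] makes the angle at [y] at least right; expanding
    the square of [x - z = (x - y) - (z - y)] then leaves only nonnegative terms to drop. *)
Lemma proj_contract (S : set 'rV[R]_n) x y z :
  convex_set S -> is_proj S x y -> S z -> norm2 (y - z) ^+ 2 <= norm2 (x - z) ^+ 2.
Proof.
move=> cS [Sy ymin] Sz.
have key t : 0 < t <= 1 -> 2 * dotv (x - y) (z - y) <= t * norm2 (z - y) ^+ 2.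
  move=> /andP[t0 t1].
  have /ymin : S (t *: z + (1 - t) *: y) by apply: convex_set_conv => //; rewrite ltW.
  rewrite -(@ler_pXn2r _ 2)// ?nnegrE ?norm2_ge0// !norm2_sqr.
  have -> : x - (t *: z + (1 - t) *: y) = (x - y) - t *: (z - y).
    by rewrite scalerBl scale1r scalerBr; apply/rowP => i; rewrite !mxE; ring.
  rewrite (dotv_sqrB (x - y)) !dotvZl !dotvZr => h.
  rewrite -(ler_pM2l t0); lra.
(* Instead of letting [t] tend to 0, the value [t = d / (d + m)] already contradicts
   [2 * d <= t * m] when [d] is positive. *)
have {key} obtuse : dotv (x - y) (z - y) <= 0.
  rewrite leNgt; apply/negP => d0.
  set d := dotv _ _ in d0 key; set m := norm2 _ ^+ 2 in key.
  have m0 : 0 <= m by exact: sqr_ge0.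
  have dm : 0 < d + m by rewrite ltr_wpDr.
  have := key (d / (d + m)).
  rewrite divr_gt0 ?ler_pdivrMr ?mul1r ?lerDl ?m0// => /(_ isT).
  rewrite leNgt => /negP; apply; rewrite mulrAC ltr_pdivrMr//.
  have := mulr_ge0 (ltW d0) m0; have := mulr_gt0 d0 d0; lra.
have -> : x - z = (x - y) - (z - y) by apply/rowP => i; rewrite !mxE; ring.
rewrite (norm2C y) !norm2_sqr (dotv_sqrB (x - y)).
have := dotv_ge0 (x - y); lra.
Qed.

Lemma derive_grad (f : 'rV[R]_n -> R) x v :
  differentiable (f : 'rV[R]_n -> R^o) x ->
  'D_v (f : 'rV[R]_n -> R^o) x = dotv (grad f x) v.
Proof.
move=> df; rewrite deriveE// {1}(row_sum_delta v) linear_sum.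
apply: eq_bigr => i _; rewrite linearZ mxE deriveE// mulrC; exact: erefl.
Qed.

(** Only the right-hand limit of the difference quotient is taken, since in the applications the
    inequality is known on the segment alone. The slack [h ^+ 2 * b] vanishes in the limit; it
    absorbs the second-order part of the strong concavity term. *)
Lemma grad_ge_quotient (f : 'rV[R]_n -> R) x v a b :
  differentiable (f : 'rV[R]_n -> R^o) x ->
  (forall h, 0 < h <= 1 -> h * a - h ^+ 2 * b <= f (h *: v + x) - f x) ->
  a <= dotv (grad f x) v.
Proof.
move=> df fh; rewrite -derive_grad//.
have /cvg_ex[l /= Dl] := @diff_derivable _ _ _ (f : _ -> R^o) x v df.
have Dr := cvg_dnbhs_at_right Dl.
have -> : 'D_v (f : 'rV[R]_n -> R^o) x = l by exact/cvg_lim.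
have {}Dr : (fun h : R => h^-1 *: (f (h *: v + x) - f x : R^o) + h * b) @ 0^'+
    --> (l + 0 * b : R).
  apply: cvgD => //; apply: cvgMl; exact: cvg_at_right_filter.
rewrite mul0r addr0 in Dr.
apply: (cvgr_to_ge Dr); near=> h.
have h0 : 0 < h by [].
have h1 : h <= 1 by near: h; exact: nbhs_right_le.
rewrite -(ler_pM2l h0) mulrDr; have := fh h; rewrite h0 h1 => /(_ isT).
rewrite [X in _ -> _ <= X + _](_ : _ = f (h *: v + x) - f x); last first.
  by rewrite /GRing.scale/= mulrA divff ?gt_eqF// mul1r.
lra.
Unshelve. all: end_near. Qed.

(** Here [m] is the modulus of strong concavity along the segment; [m = 0] gives the plain gradient
    inequality, used below for convex functions after a change of sign. *)
Lemma grad_concave_le (f : 'rV[R]_n -> R) (m : R) x y :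
  differentiable (f : 'rV[R]_n -> R^o) x ->
  (forall t, 0 <= t <= 1 -> t * f y + (1 - t) * f x
     + m / 2 * t * (1 - t) * norm2 (y - x) ^+ 2 <= f (t *: y + (1 - t) *: x)) ->
  f y - f x + m / 2 * norm2 (y - x) ^+ 2 <= dotv (grad f x) (y - x).
Proof.
move=> df cf; apply: (@grad_ge_quotient _ _ _ _ (m / 2 * norm2 (y - x) ^+ 2)) => //.
move=> h /andP[h0 h1]; have := cf h; rewrite (ltW h0) h1 => /(_ isT).
have -> : h *: (y - x) + x = h *: y + (1 - h) *: x.
  by apply/rowP => i; rewrite !mxE; ring.
lra.
Qed.

Lemma gradN (f : 'rV[R]_n -> R) x :
  differentiable (f : 'rV[R]_n -> R^o) x ->
  grad (fun u => - f u) x = - grad f x.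
Proof.
move=> df; apply/rowP => i; rewrite !mxE.
exact: (@deriveN _ _ _ (f : _ -> R^o) x _ (diff_derivable df)).
Qed.

Lemma grad_convex_le (S : set 'rV[R]_n) (f : 'rV[R]_n -> R) x y :
  convex_function S f -> S x -> S y ->
  differentiable (f : 'rV[R]_n -> R^o) x ->
  dotv (grad f x) (y - x) <= f y - f x.
Proof.
move=> cf Sx Sy df.
have dNf : differentiable ((fun u => - f u) : 'rV[R]_n -> R^o) x.
  exact: (@differentiableN _ _ _ (f : _ -> R^o)).
have := @grad_concave_le _ 0 x y dNf; rewrite gradN// dotvNl => h.
have {h}/h : forall t, 0 <= t <= 1 -> t * - f y + (1 - t) * - f x
     + 0 / 2 * t * (1 - t) * norm2 (y - x) ^+ 2 <= - f (t *: y + (1 - t) *: x).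
  by move=> t t01; have := convex_function_conv cf Sy Sx t01; lra.
lra.
Qed.

End euclid.

(** * Inner maximization *)

Section uniform_bounds.
Context (R : realType) (n : nat).
Implicit Types (S : set 'rV[R]_n) (u v w x y z : 'rV[R]_n).

(** Ranks are at most [n], so some family of members of [S] has maximal rank; appending a further
    member cannot raise the rank, so it already lies in the span. *)
Lemma exists_spanning_rows S : exists k (B : 'M[R]_(k, n)),
  (forall i, S (row i B)) /\ (forall s, S s -> (s <= B)%MS).
Proof.
pose P r := `[< exists k (B : 'M[R]_(k, n)), (forall i, S (row i B)) /\ \rank B = r >].
have P0 : exists r, P r.
  exists 0%N; apply/asboolP; exists 0%N, 0; split; first by case.
  exact: mxrank0.
have Pn r : P r -> (r <= n)%N by move=> /asboolP[k [B [_ <-]]]; exact: rank_leq_col.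
have [r /asboolP[k [B [SB <-]]] rmax] := ex_maxnP P0 Pn.
exists k, B; split => // s Ss.
have /rmax : P (\rank (col_mx B s)).
  apply/asboolP; exists (k + 1)%N, (col_mx B s); split => // i.
  rewrite -(splitK i); case: (fintype.split i) => j /=.
    by rewrite rowKu.
  by rewrite rowKd (ord1 j) row_id.
rewrite -addsmxE => rle.
have := addsmxSl B s; rewrite (geq_leqif (mxrank_leqif_sup (addsmxSl B s))) in rle.
by move=> _; apply: submx_trans rle; exact: addsmxSr.
Qed.

(** A finite-dimensional uniform boundedness principle: bounds at finitely many spanning points
    suffice, because the coordinates of [u - v] on them, given by [pinvmx B], are linear in [u - v]
    and hence controlled by its norm. *)
Lemma dotv_bounded_on_span S (A : Type) (D : set A) (g : A -> 'rV[R]_n) :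
  (forall s, S s -> exists b, forall a, D a -> `|dotv (g a) s| <= b) ->
  exists2 K, 0 <= K & forall a u v, D a -> S u -> S v ->
    `|dotv (g a) (u - v)| <= K * norm2 (u - v).
Proof.
move=> gb; have [k [B [SB Bspan]]] := exists_spanning_rows S.
have [b bP] := choice (fun i => gb _ (SB i)).
pose K := \sum_i `|b i| * \sum_j `|pinvmx B j i|.
exists K; first by apply: sumr_ge0 => i _; rewrite mulr_ge0// sumr_ge0.
move=> a u v Da /Bspan uB /Bspan vB; set w := u - v.
have wB : (w <= B)%MS by rewrite addmx_sub// eqmx_opp.
rewrite -{1}(mulmxKpV wB) mulmx_sum_row dotvC dotv_suml mulr_suml.
apply: le_trans (ler_norm_sum _ _ _) _; apply: ler_sum => i _.
rewrite dotvZl dotvC normrM mulrC -mulrA ler_pM//.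
  exact: le_trans (bP i _ Da) (ler_norm _).
rewrite mxE mulr_suml; apply: le_trans (ler_norm_sum _ _ _) _.
apply: ler_sum => j _; rewrite normrM mulrC ler_wpM2l//.
exact: normr_coord_le_norm2.
Qed.

(* [S] may be unbounded and have empty interior, so the gradients at [y0] are only
   controlled along differences of points of [S]; strong concavity keeps the
   maximizers in a fixed ball around [y0]. *)
Lemma concave_family_bounds (A : Type) (D : set A) (G : A -> 'rV[R]_n -> R) S y0
    (m B l : R) :
  0 < m -> 0 <= B -> 0 <= l -> S y0 ->
  (forall a x y t, D a -> S x -> S y -> 0 <= t <= 1 ->
     t * G a y + (1 - t) * G a x + m / 2 * t * (1 - t) * norm2 (y - x) ^+ 2
       <= G a (t *: y + (1 - t) *: x)) ->
  (forall a x, D a -> S x -> differentiable (G a : 'rV[R]_n -> R^o) x) ->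
  (forall a x y, D a -> S x -> S y ->
     norm2 (grad (G a) x - grad (G a) y) <= l * norm2 (x - y)) ->
  (forall a a' x, D a -> D a' -> S x -> G a x - G a' x <= B) ->
  exists2 K, 0 <= K & forall a, D a ->
    (forall x, S x -> G a x <= K) /\
    (forall x z, argmax_set S (G a) x -> S z ->
       G a x - G a z <= K * (1 + norm2 (z - x)) * norm2 (z - x)).
Proof.
move=> m0 B0 l0 Sy0 conc dG smooth Gdiff.
have gradle a x y : D a -> S x -> S y ->
    G a y - G a x + m / 2 * norm2 (y - x) ^+ 2 <= dotv (grad (G a) x) (y - x).
  by move=> Da Sx Sy; apply: grad_concave_le; [exact: dG|move=> t; exact: conc].
have gradle0 a x y : D a -> S x -> S y ->
    G a y - G a x <= dotv (grad (G a) x) (y - x).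
  move=> Da Sx Sy; apply: le_trans (gradle _ _ _ Da Sx Sy).
  by rewrite lerDl mulr_ge0// ?divr_ge0 ?(ltW m0)// sqr_ge0.
have [[a0 Da0]|/forallNP D0] := pselect (exists a, D a); last by exists 0 => // a /D0.
have [K1 K10 K1P] : exists2 K1, 0 <= K1 & forall a x z, D a -> S x -> S z ->
    `|dotv (grad (G a) y0) (x - z)| <= K1 * norm2 (x - z).
  have [|K1 K10 K1P] := @dotv_bounded_on_span [set y - y0 | y in S] A D
      (fun a => grad (G a) y0).
    (* Concavity at [y0] bounds the slope towards [y] from below by [G a y - G a y0]; concavity at
       [y] and smoothness bound it from above by the same increment plus [l * norm2 (y - y0) ^+ 2].
       Replacing [a] by [a0] in the increment costs [2 * B]. *)
    move=> _ [y Sy <-]; exists (`|G a0 y - G a0 y0| + 2 * B + l * norm2 (y - y0) ^+ 2).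
    move=> a Da; have h1 := gradle0 a y0 y Da Sy0 Sy.
    have h2 := gradle0 a y y0 Da Sy Sy0.
    have h3 := smooth a y0 y Da Sy0 Sy.
    have h4 := le_trans (cauchy_schwarz _ _) (ler_wpM2r (norm2_ge0 (y - y0)) h3).
    rewrite -(opprB y y0) norm2N dotvNr in h2 h4 *.
    rewrite dotvBl -mulrA -expr2 in h4.
    have := Gdiff a a0 y Da Da0 Sy; have := Gdiff a0 a y Da0 Da Sy.
    have := Gdiff a a0 y0 Da Da0 Sy0; have := Gdiff a0 a y0 Da0 Da Sy0.
    have := ler_norm (G a0 y - G a0 y0); have := ler_norm (- (G a0 y - G a0 y0)).
    have : 0 <= l * norm2 (y - y0) ^+ 2 by rewrite mulr_ge0// sqr_ge0.
    by rewrite normrN ler_norml => *; apply/andP; split; lra.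
  exists K1 => // a x z Da Sx Sz.
  have -> : x - z = (x - y0) - (z - y0) by rewrite opprB addrA subrK.
  by apply: K1P => //; [exists x|exists z].
pose N := norm2 (grad (G a0) y0).
have N0 : 0 <= N by exact: norm2_ge0.
have growth y : S y -> G a0 y - G a0 y0 + m / 2 * norm2 (y - y0) ^+ 2 <= N * norm2 (y - y0).
  move=> Sy; apply: le_trans (cauchy_schwarz _ _); exact: gradle.
(* A maximizer [x] of [G a] satisfies [G a0 x >= G a0 y0 - 2 * B]. By [growth], its distance [d] to
   [y0] then satisfies [m / 2 * d ^+ 2 <= N * d + 2 * B]; for [d > 1], divide by [d]. The summand 1
   covers [d <= 1]. *)
pose r := 1 + 2 / m * (N + 2 * B).
have r1 : 0 <= 2 / m * (N + 2 * B).
  by rewrite mulr_ge0 ?addr_ge0// ?divr_ge0 ?mulr_ge0// ltW.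
have r0 : 0 <= r by rewrite addr_ge0.
have xr a x : D a -> argmax_set S (G a) x -> norm2 (x - y0) <= r.
  move=> Da [Sx xmax]; have := growth x Sx; have := xmax _ Sy0.
  have := Gdiff a a0 x Da Da0 Sx; have := Gdiff a0 a y0 Da0 Da Sy0.
  set d := norm2 (x - y0) => h1 h2 h3 h4; have d0 : 0 <= d by exact: norm2_ge0.
  have [d1|d1] := leP d 1; first by rewrite (le_trans d1)// lerDl.
  rewrite /r -(ler_pM2l m0) mulrDr mulr1 mulrA [m * (2 / m)]mulrC divfK ?gt_eqF//.
  rewrite -(ler_pM2r (lt_trans ltr01 d1)).
  have : 0 <= 2 * B * (d - 1) by rewrite mulr_ge0 ?mulr_ge0// subr_ge0 ltW.
  have : 0 <= m * d by rewrite mulr_ge0// ltW.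
  lra.
(* The last term is the maximum over [d] of [N * d - m / 2 * d ^+ 2], the largest gain over
   [G a0 y0] that [growth] permits. *)
pose M := `|G a0 y0| + B + N ^+ 2 / (2 * m).
have M0 : 0 <= M by rewrite !addr_ge0// divr_ge0 ?sqr_ge0// mulr_ge0// ltW.
have lr0 : 0 <= l * (1 + r) by rewrite mulr_ge0// addr_ge0.
exists (M + K1 + l * (1 + r)); first by apply: addr_ge0 => //; exact: addr_ge0.
move=> a Da; split => [x Sx|x z xmax Sz].
  have : G a x <= M; last by move=> h; apply: le_trans h _; lra.
  have := growth x Sx; have := Gdiff a a0 x Da Da0 Sx.
  have := ler_norm (G a0 y0); rewrite /M; set d := norm2 _.
  have : N * d - m / 2 * d ^+ 2 = N ^+ 2 / (2 * m) - (N - m * d) ^+ 2 / (2 * m).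
    by field; rewrite gt_eqF.
  have : 0 <= (N - m * d) ^+ 2 / (2 * m).
    by rewrite divr_ge0 ?sqr_ge0// mulr_ge0// ltW.
  lra.
have [Sx _] := xmax; have xr_ := xr a x Da xmax.
(* The slope is taken at [z]: it differs from the slope at [y0], bounded through [K1], by at most
   [l * norm2 (z - y0)], and [z] is within [d + r] of [y0]. This dependence on [d] is the reason for
   the factor [1 + norm2 (z - x)]. *)
have h1 := gradle0 a z x Da Sz Sx.
have h2 := le_trans (cauchy_schwarz _ _)
   (ler_wpM2r (norm2_ge0 (x - z)) (smooth a z y0 Da Sz Sy0)).
have h3 := le_trans (ler_norm _) (K1P a x z Da Sx Sz).
rewrite dotvBl in h2.
rewrite (norm2C z x); set d := norm2 (x - z) in h1 h2 h3 *.
have d0 : 0 <= d by exact: norm2_ge0.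
have h4 : norm2 (z - y0) <= d + r.
  rewrite (_ : z - y0 = (z - x) + (x - y0)); last by rewrite addrA subrK.
  by rewrite (le_trans (norm2D _ _))// norm2C lerD2l.
have h5 : G a x - G a z <= (l * (d + r) + K1) * d.
  have := ler_wpM2r d0 (ler_wpM2l l0 h4); lra.
apply: (le_trans h5); rewrite ler_wpM2r//.
have Md : 0 <= M * (1 + d) by rewrite mulr_ge0// addr_ge0.
have K1d : 0 <= K1 * d by rewrite mulr_ge0.
have lrd : 0 <= l * r * d by rewrite !mulr_ge0.
lra.
Qed.

End uniform_bounds.

(** * Effect of the inner accuracy on the exponential risk *)

Section robust.
Context (R : realType) (p q : nat).
Implicit Types (Theta : set 'rV[R]_p) (Xi : set 'rV[R]_q).

Lemma robust_loss_argmax Xi (L : 'rV[R]_p -> 'rV[R]_q -> R) c rho th zeta x :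
  argmax_set Xi (penalized L c rho th zeta) x ->
  robust_loss Xi L c rho th zeta = penalized L c rho th zeta x.
Proof.
move=> [Xx xmax]; apply/eqP; rewrite eq_le; apply/andP; split.
  by apply: ge_sup; [by exists (penalized L c rho th zeta x), x|move=> _ [y Xy <-]; exact: xmax].
apply: ub_le_sup; last by exists x.
by exists (penalized L c rho th zeta x) => _ [y Xy <-]; exact: xmax.
Qed.

Lemma expR_sub_le (a b : R) : expR a - expR b <= expR a * (a - b).
Proof.
have -> : expR b = expR a * expR (b - a) by rewrite -expRD addrC subrK.
have := ler_wpM2l (expR_ge0 a) (expR_ge1Dx (b - a)); lra.
Qed.

(** For [eps < 1] the tangent inequality of [expR] reduces the error to the gap in [penalized],
    which is at most [3 * K * eps]. For [eps >= 1] the left side never exceeds [expR (s * K)], so a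
    single constant serves all accuracies. *)
Lemma inner_error_bound Xi (L : 'rV[R]_p -> 'rV[R]_q -> R) c rho (s K : R) th zeta z eps :
  0 <= s -> 0 <= K -> 0 <= eps ->
  (forall x, Xi x -> penalized L c rho th zeta x <= K) ->
  (forall x z, argmax_set Xi (penalized L c rho th zeta) x -> Xi z ->
       penalized L c rho th zeta x - penalized L c rho th zeta z
         <= K * (1 + norm2 (z - x)) * norm2 (z - x)) ->
  Xi z -> (dist_to z (argmax_set Xi (penalized L c rho th zeta)) <= eps%:E)%E ->
  expR (s * robust_loss Xi L c rho th zeta) - expR (s * penalized L c rho th zeta z)
    <= expR (s * K) * (1 + 3 * s * K) * eps.
Proof.
move=> s0 K0 eps0 penK penlip Xz dz; set f := robust_loss _ _ _ _ _ _.
(* The distance is an infimum not known to be attained, so maximizers are found within every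
   distance larger than [eps]. In particular one exists, since the distance to the empty set is
   infinite. *)
have near d : eps < d -> exists2 x, argmax_set Xi (penalized L c rho th zeta) x & norm2 (z - x) < d.
  move=> epsd; have /ereal_inf_lt[_ [x xmax <-] zx] : (dist_to z
     (argmax_set Xi (penalized L c rho th zeta)) < d%:E)%E.
    by rewrite (le_lt_trans dz)// lte_fin.
  by exists x => //; rewrite -lte_fin.
have fK : f <= K.
  have [|x xmax _] := near (eps + 1); first by rewrite ltrDl.
  by rewrite /f (robust_loss_argmax xmax) penK//; case: xmax.
have efK : expR (s * f) <= expR (s * K) by rewrite ler_expR ler_wpM2l.
have [eps1|eps1] := leP 1 eps.
  have e0 : 0 <= expR (s * K) by exact: expR_ge0.
  have ep := expR_ge0 (s * penalized L c rho th zeta z).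
  have sK : 0 <= 3 * s * K by rewrite !mulr_ge0.
  apply: (@le_trans _ _ (expR (s * K) * eps)); last first.
    by rewrite ler_wpM2r// ler_peMr// lerDl.
  by rewrite (@le_trans _ _ (expR (s * K)))// ?ler_peMr//; lra.
(* With [eps < 1] and [dl <= 1] the distance [d] is at most 2, so [1 + d <= 3]; [dl] is chosen to
   keep the excess [3 * K * dl] below [e]. *)
have fpen : f - penalized L c rho th zeta z <= 3 * K * eps.
  apply/ler_addgt0Pr => e e0.
  have k0 : 0 < 3 * K + 1 by rewrite ltr_wpDl// mulr_ge0.
  pose dl := Num.min 1 (e / (3 * K + 1)).
  have dl0 : 0 < dl by rewrite lt_min ltr01 divr_gt0.
  have [|x xmax zx] := near (eps + dl); first by rewrite ltrDl.
  rewrite /f (robust_loss_argmax xmax) (le_trans (penlip _ _ xmax Xz))//.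
  set d := norm2 _ in zx *; have d0 : 0 <= d by exact: norm2_ge0.
  have dl1 : dl <= 1 by rewrite ge_min lexx.
  have dle : dl * (3 * K + 1) <= e.
    by rewrite -ler_pdivlMr// ge_min lexx orbT.
  have Kd : 0 <= K * d by rewrite mulr_ge0.
  have d2 : d <= 2 by lra.
  have Kdd : K * d * d <= K * d * 2 by rewrite ler_wpM2l.
  have Kzx : K * d <= K * (eps + dl) by rewrite ler_wpM2l// ltW.
  lra.
apply: le_trans (expR_sub_le _ _) _; rewrite -mulrBr.
have sK : 0 <= s * (3 * K * eps) by rewrite !mulr_ge0.
apply: (@le_trans _ _ (expR (s * K) * (s * (3 * K * eps)))).
  apply: (@le_trans _ _ (expR (s * f) * (s * (3 * K * eps)))).
    by rewrite ler_wpM2l ?expR_ge0// ler_wpM2l.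
  by rewrite ler_wpM2r.
rewrite -[leRHS]mulrA ler_wpM2l ?expR_ge0//; lra.
Qed.

End robust.

(** * Martingale noise *)

Section bounded_measurable.
Context (R : realType) (d : measure_display) (Omega : measurableType d).
Implicit Types (G : set (set Omega)) (X Y : Omega -> R) (A : set Omega).

(** A copy of [Omega] carrying the generated sigma-algebra makes the usual closure rules available
    for sub-sigma-algebras; boundedness gives integrability under any probability. *)
Definition bmeas G Y :=
  measurable_fun [set: g_sigma_algebraType G] (Y : g_sigma_algebraType G -> R) /\
  exists B, forall w, `|Y w| <= B.

Lemma bmeas_cst G r : bmeas G (fun=> r).
Proof. by split; [exact: measurable_cst|exists `|r|]. Qed.

Lemma bmeasD G X Y : bmeas G X -> bmeas G Y -> bmeas G (fun w => X w + Y w).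
Proof.
move=> [mX [B XB]] [mY [C YC]]; split; first exact: measurable_funD.
by exists (B + C) => w; rewrite (le_trans (ler_normD _ _))// lerD.
Qed.

Lemma bmeasM G X Y : bmeas G X -> bmeas G Y -> bmeas G (fun w => X w * Y w).
Proof.
move=> [mX [B XB]] [mY [C YC]]; split; first exact: measurable_funM.
by exists (B * C) => w; rewrite normrM ler_pM.
Qed.

Lemma bmeasZ G r Y : bmeas G Y -> bmeas G (fun w => r * Y w).
Proof. by apply: bmeasM; exact: bmeas_cst. Qed.

Lemma bmeasB G X Y : bmeas G X -> bmeas G Y -> bmeas G (fun w => X w - Y w).
Proof.
move=> bX bY; rewrite (_ : (fun _ => _) = fun w => X w + -1 * Y w).
  by apply: bmeasD => //; exact: bmeasZ.
by apply/funext => w; rewrite mulN1r.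
Qed.

Lemma bmeas_sum G (I : eqType) (r : seq I) (Y : I -> Omega -> R) :
  (forall i, i \in r -> bmeas G (Y i)) -> bmeas G (fun w => \sum_(i <- r) Y i w).
Proof.
elim: r => [_|i r IH Yr].
  by under eq_fun do rewrite big_nil; exact: bmeas_cst.
under eq_fun do rewrite big_cons.
apply: bmeasD; first by apply: Yr; rewrite mem_head.
by apply: IH => j jr; apply: Yr; rewrite inE jr orbT.
Qed.

Lemma bmeasS G G' Y : G `<=` G' -> bmeas G Y -> bmeas G' Y.
Proof.
move=> GG' [mY bY]; split => // _ B mB; have := mY measurableT B mB.
by apply: sub_smallest2r => //; exact: smallest_sigma_algebra.
Qed.

Lemma bmeas_indic G A : G A -> bmeas G (\1_A : Omega -> R).
Proof.
move=> GA; split; last first.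
  by exists 1 => w; rewrite indicE; case: (_ \in _); rewrite ?normr1// normr0.
by apply: (@measurable_indic _ (g_sigma_algebraType G)); exact: sub_sigma_algebra.
Qed.

Variables (P : probability Omega R) (G : set (set Omega)).
Hypothesis Gmeas : forall A, G A -> measurable A.

Lemma bmeas_measurable Y : bmeas G Y -> measurable_fun [set: Omega] Y.
Proof.
move=> [mY _] _ B mB; have := mY measurableT B mB.
rewrite -[X in X -> _]/(<<s G >> _); apply: smallest_sub; last exact: Gmeas.
exact: sigma_algebra_measurable.
Qed.

Lemma measurable_fun_id_sub :
  measurable_fun [set: Omega] (id : Omega -> g_sigma_algebraType G).
Proof.
move=> _ B; rewrite setTI preimage_id; apply: smallest_sub; last exact: Gmeas.
exact: sigma_algebra_measurable.
Qed.

Lemma bmeas_integrable Y : bmeas G Y -> P.-integrable [set: Omega] (EFin \o Y).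
Proof.
move=> bY; have mY := bmeas_measurable bY; case: bY => _ [B YB].
apply: (measurable_bounded_integrable measurableT) => //.
  exact: le_lt_trans (probability_le1 P measurableT) (ltry _).
exists B; split; first exact: num_real.
by move=> M BM w _; apply: le_trans (YB w) _; exact: ltW.
Qed.

(** [P] is the sum of its restrictions to [A] and to the complement. The function cut off by the
    indicator of [A] integrates to zero against the second, and agrees with [f] almost everywhere
    for the first. *)
Lemma ge0_integral_mrestr A (mA : measurable A) (f : Omega -> \bar R) :
  measurable_fun setT f -> (forall w, 0 <= f w)%E ->
  (\int[mrestr P mA]_w f w = \int[P]_w (f w * (\1_A w)%:E))%E.
Proof.
move=> mf f0; pose mAc := measurableC mA.
pose g := (fun w => f w * (\1_A w)%:E)%E.
have mg : measurable_fun setT g.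
  by apply: emeasurable_funM => //; apply/measurable_EFinP; exact: measurable_indic.
have g0 w : (0 <= g w)%E by rewrite mule_ge0// lee_fin.
transitivity (\int[mrestr P mA]_w g w)%E.
  apply: ge0_ae_eq_integral => //; exists (~` A); split.
  - exact: measurableC.
  - by rewrite -[LHS]/(P (~` A `&` A)) setICl measure0.
  move=> w /= h Aw; apply: h => _ /=; rewrite /g indicE mem_set// mule1; exact: erefl.
have -> : (\int[P]_w g w = \int[measure_add (mrestr P mA) (mrestr P mAc)]_w g w)%E.
  apply: eq_measure_integral => B mB _; apply: etrans (esym (measure_addE _ _ _)).
  rewrite -{1}(setIT B) -(setUv A) setIUr measureU//; try exact: measurableI.
  by rewrite setIACA setICr setI0.
rewrite ge0_integral_measure_add//.
rewrite [X in (_ + X)%E](_ : _ = 0)%E ?adde0//.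
rewrite -(integral0 (mrestr P mAc) setT).
apply: ge0_ae_eq_integral => //; exists A; split => //.
  by rewrite -[LHS]/(P (A `&` ~` A)) setICr measure0.
move=> w /= h; apply: contrapT => Aw; apply: h => _.
by rewrite /g indicE memNset// mule0.
Qed.

(** Independence says that, on the sigma-algebra generated by [G], the restriction of [P] to [A] is
    [e] times [P]. Pushed to the coarser measurable space by the identity, the two measures
    coincide, and [Y] is measurable there. *)
Lemma ge0_integral_indep A (e : R) Y : measurable A -> 0 <= e -> bmeas G Y ->
  (forall w, 0 <= Y w) ->
  (forall B, <<s G >> B -> P (B `&` A) = (P B * e%:E)%E) ->
  (\int[P]_w (Y w * \1_A w)%:E = e%:E * \int[P]_w (Y w)%:E)%E.
Proof.
move=> mA e0 [mY bY] Y0 PA.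
pose T' := g_sigma_algebraType G.
pose sub : {mfun Omega >-> T'} :=
  HB.pack (id : Omega -> T') (isMeasurableFun.Build _ _ _ _ _ measurable_fun_id_sub).
have mf : measurable_fun [set: T'] (EFin \o (Y : T' -> R)) by exact/measurable_EFinP.
have mY' : measurable_fun [set: Omega] (EFin \o Y).
  by apply/measurable_EFinP; exact: bmeas_measurable.
transitivity (\int[mrestr P mA]_w (Y w)%:E)%E.
  by rewrite ge0_integral_mrestr.
transitivity (\int[pushforward (mrestr P mA) sub]_w (Y w)%:E)%E.
  rewrite ge0_integral_pushforward//.
  by move=> w _; rewrite lee_fin.
transitivity (\int[mscale (NngNum e0) (distribution P sub)]_w (Y w)%:E)%E.
  apply: eq_measure_integral => B mB _.
  by rewrite /pushforward/= /mscale/= /mrestr muleC -PA.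
rewrite ge0_integral_mscale//; last by move=> w _; rewrite lee_fin.
congr (_ * _)%E; rewrite ge0_integral_pushforward//.
by move=> w _; rewrite lee_fin.
Qed.

Lemma Rintegral_bmeasD X Y : bmeas G X -> bmeas G Y ->
  \int[P]_w (X w + Y w) = \int[P]_w X w + \int[P]_w Y w.
Proof. by move=> bX bY; apply: RintegralD => //; exact: bmeas_integrable. Qed.

Lemma Rintegral_bmeasB X Y : bmeas G X -> bmeas G Y ->
  \int[P]_w (X w - Y w) = \int[P]_w X w - \int[P]_w Y w.
Proof. by move=> bX bY; apply: RintegralB => //; exact: bmeas_integrable. Qed.

Lemma Rintegral_bmeasZ r Y : bmeas G Y ->
  \int[P]_w (r * Y w) = r * \int[P]_w Y w.
Proof. by move=> bY; apply: RintegralZl => //; exact: bmeas_integrable. Qed.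

Lemma Rintegral_bmeas_cst r : \int[P]_w (cst r w) = r.
Proof. 
by rewrite Rintegral_cst// [X in fine X](_ : _ = 1%E) ?mulr1//; exact: probability_setT.
 Qed.

Lemma Rintegral_bmeas_sum (I : eqType) (r : seq I) (Y : I -> Omega -> R) :
  (forall i, i \in r -> bmeas G (Y i)) ->
  \int[P]_w (\sum_(i <- r) Y i w) = \sum_(i <- r) \int[P]_w Y i w.
Proof.
elim: r => [_|i r IH Yr].
  rewrite big_nil; under eq_Rintegral do rewrite big_nil.
  exact: Rintegral_bmeas_cst.
rewrite big_cons; under eq_Rintegral do rewrite big_cons.
rewrite Rintegral_bmeasD ?IH//.
- by move=> j jr; apply: Yr; rewrite inE jr orbT.
- by apply: Yr; rewrite mem_head.
- by apply: bmeas_sum => j jr; apply: Yr; rewrite inE jr orbT.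
Qed.

Lemma le_Rintegral_bmeas X Y : bmeas G X -> bmeas G Y ->
  (forall w, X w <= Y w) -> \int[P]_w X w <= \int[P]_w Y w.
Proof. by move=> bX bY XY; apply: le_Rintegral => //; exact: bmeas_integrable. Qed.

End bounded_measurable.

Section martingale.
Context (R : realType) (d : measure_display) (Omega : measurableType d).
Context (P : probability Omega R).
Implicit Types (G : set (set Omega)) (X Y : Omega -> R) (A : set Omega).

Let E Y := \int[P]_w Y w.

(** Here [e] is the probability of [A], so its centered indicator is orthogonal to the past. A
    signed [Y] is the difference of the nonnegative functions [Y + |B|] and [|B|], to which the
    nonnegative case applies. *)
Lemma Rintegral_indep G A (e : R) Y :
  (forall B, G B -> measurable B) -> measurable A -> 0 <= e -> bmeas G Y ->
  (forall B, <<s G >> B -> P (B `&` A) = (P B * e%:E)%E) ->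
  E (fun w => Y w * (\1_A w - e)) = 0.
Proof.
move=> Gm mA e0 bY PA.
have mm A' : @measurable _ Omega A' -> measurable A' by [].
have bYm : bmeas measurable Y.
  by apply: bmeasS bY => B; exact: Gm.
have bA : bmeas measurable (\1_A : Omega -> R) by exact: bmeas_indic.
have ge0_case X : bmeas G X -> (forall w, 0 <= X w) ->
    E (fun w => X w * (\1_A w - e)) = 0.
  move=> bX X0; have bXm : bmeas measurable X by apply: bmeasS bX => B; exact: Gm.
  under eq_fun do rewrite mulrBr (mulrC _ e).
  rewrite /E (Rintegral_bmeasB _ mm); [|exact: bmeasM|exact: bmeasZ].
  rewrite (Rintegral_bmeasZ _ mm)// /Rintegral (ge0_integral_indep Gm mA e0 bX X0 PA).
  rewrite fineM ?subrr// integrable_fin_num//; exact: bmeas_integrable bX.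
have [B YB] := bY.2.
have bC : bmeas G (fun=> `|B|) by exact: bmeas_cst.
have -> : (fun w => Y w * (\1_A w - e)) =
    fun w => (Y w + `|B|) * (\1_A w - e) - `|B| * (\1_A w - e).
  by apply/funext => w; rewrite -mulrBl addrK.
have bAe : bmeas measurable (fun w => \1_A w - e).
  by apply: bmeasB => //; exact: bmeas_cst.
have bCm : bmeas measurable (fun _ : Omega => `|B|) by exact: bmeas_cst.
rewrite /E (Rintegral_bmeasB _ mm); [|by apply: bmeasM => //; exact: bmeasD|exact: bmeasM].
rewrite -/(E _) -/(E _) !ge0_case ?subr0//; first exact: bmeasD.
move=> w; have := YB w; have := ler_norm B; have := ler_norm (- Y w).
rewrite normrN; lra.
Qed.

(* The increments [D t] are orthogonal, so the cross terms vanish. *)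
Lemma martingale_second_moment (F : nat -> set (set Omega)) (D : nat -> Omega -> R)
    (T : nat) (c : R) :
  (forall t A, F t A -> measurable A) ->
  (forall s t, (s <= t)%N -> F s `<=` F t) ->
  (forall t, (1 <= t <= T)%N -> bmeas (F t.+1) (D t)) ->
  (forall t w, (1 <= t <= T)%N -> `|D t w| <= c) ->
  (forall t Y, (1 <= t <= T)%N -> bmeas (F t) Y -> E (fun w => Y w * D t w) = 0) ->
  E (fun w => (\sum_(1 <= t < T.+1) D t w) ^+ 2) <= T%:R * c ^+ 2.
Proof.
move=> Fm Fmono bD Dc DY.
pose S n w := \sum_(1 <= t < n.+1) D t w.
have bS n : (n <= T)%N -> bmeas (F n.+1) (S n).
  move=> nT; apply: bmeas_sum => t; rewrite mem_index_iota ltnS => /andP[t1 tn].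
  by apply: (@bmeasS _ _ _ (F t.+1)); [exact: Fmono|apply: bD; rewrite t1 (leq_trans tn)].
suff : forall n, (n <= T)%N -> E (fun w => S n w ^+ 2) <= n%:R * c ^+ 2 by exact.
elim=> [_|n IH nT].
  rewrite (_ : (fun _ => _) = cst 0); first by rewrite /E Rintegral_bmeas_cst mul0r.
  by apply/funext => w; rewrite /S big_geq// expr0n.
have n1 : (1 <= n.+1 <= T)%N by [].
have bSn : bmeas (F n.+2) (S n).
  by apply: (@bmeasS _ _ _ (F n.+1)); [exact: Fmono|exact/bS/ltnW].
have bDn := bD _ n1.
have -> : (fun w => S n.+1 w ^+ 2) =
    fun w => S n w * S n w + (2 * (S n w * D n.+1 w) + D n.+1 w * D n.+1 w).
  by apply/funext => w; rewrite /S big_nat_recr//=; ring.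
have bSS := bmeasM bSn bSn; have bSD := bmeasM bSn bDn; have bDD := bmeasM bDn bDn.
rewrite /E (Rintegral_bmeasD _ (Fm n.+2))//; last by apply: bmeasD => //; exact: bmeasZ.
rewrite (Rintegral_bmeasD _ (Fm n.+2))//; last exact: bmeasZ.
rewrite (Rintegral_bmeasZ _ (Fm n.+2))// -/(E (fun w => S n w * D n.+1 w)).
rewrite DY//; last exact/bS/ltnW.
rewrite mulr0 add0r -natr1 mulrDl mul1r lerD//.
  by apply: le_trans (IH (ltnW nT)); under eq_fun do rewrite -expr2.
rewrite -[leRHS](Rintegral_bmeas_cst P); apply: (le_Rintegral_bmeas _ (Fm n.+2)) => //.
  exact: bmeas_cst.
move=> w; rewrite -expr2 -real_normK ?num_real//.
by rewrite ler_pXn2r ?nnegrE ?Dc// (le_trans _ (Dc _ w n1)).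
Qed.

End martingale.

(** * Regret and convexity of the risk *)

Section online_gradient.
Context (R : realType) (n : nat).

(** Projection does not increase the distance to [u], so expanding the square gives a telescoping
    sum of squared distances; the induction keeps the last distance, which is dropped at the end.
    The ascent player is covered by changing the sign of [g]. *)
Lemma projected_gradient_regret (S : set 'rV[R]_n) (x g : nat -> 'rV[R]_n) (u : 'rV[R]_n)
    (T : nat) (eta D G : R) :
  convex_set S -> S u -> 0 < eta ->
  (forall t, (1 <= t <= T)%N -> is_proj S (x t - eta *: g t) (x t.+1)) ->
  (forall t, (1 <= t <= T)%N -> norm2 (g t) <= G) -> norm2 (x 1%N - u) <= D ->
  \sum_(1 <= t < T.+1) dotv (g t) (x t - u)
    <= D ^+ 2 / (2 * eta) + T%:R * (eta * G ^+ 2 / 2).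
Proof.
move=> cS Su eta0 xproj gG x1D.
suff : forall k, (k <= T)%N -> 2 * eta * \sum_(1 <= t < k.+1) dotv (g t) (x t - u)
    + norm2 (x k.+1 - u) ^+ 2 <= D ^+ 2 + k%:R * (eta ^+ 2 * G ^+ 2).
  move=> /(_ T (leqnn T)) h.
  have e2 : 0 < 2 * eta by rewrite mulr_gt0.
  rewrite -(ler_pM2l e2) mulrDr mulrCA divff ?gt_eqF// mulr1.
  have := sqr_ge0 (norm2 (x T.+1 - u)); lra.
elim=> [_|k IH kT].
  rewrite big_geq// mulr0 add0r mul0r addr0 ler_pXn2r ?nnegrE ?norm2_ge0//.
  exact: le_trans (norm2_ge0 _) x1D.
have k1 : (1 <= k.+1 <= T)%N by [].
have := IH (ltnW kT); have := proj_contract cS (xproj _ k1) Su.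
rewrite -natr1 (big_nat_recr k.+1)//.
rewrite (_ : x k.+1 - eta *: g k.+1 - u = (x k.+1 - u) - eta *: g k.+1); last first.
  by rewrite addrAC.
have : norm2 (g k.+1) ^+ 2 <= G ^+ 2.
  by rewrite ler_pXn2r ?nnegrE ?norm2_ge0 ?gG// (le_trans (norm2_ge0 _) (gG _ k1)).
move=> /(ler_wpM2l (sqr_ge0 eta)).
rewrite !norm2_sqr (dotv_sqrB (x k.+1 - u)) !dotvZr dotvZl (dotvC (x k.+1 - u)).
rewrite !mulrDr.
lra.
Qed.

End online_gradient.

(** * Means over finite datasets *)

Section finite_mixture.
Context (R : realType) (q N : nat) (data : 'I_N -> seq 'rV[R]_q).

Lemma empirical_ge0 i x : 0 <= empirical (data i) x.
Proof. by rewrite divr_ge0. Qed.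

Lemma empirical_le1 i x : empirical (data i) x <= 1.
Proof.
rewrite /empirical; have [->|] := posnP (size (data i)).
  by rewrite invr0 mulr0.
by move=> s0; rewrite ler_pdivrMr ?ltr0n// mul1r ler_nat count_size.
Qed.

(** One duplicate-free list shared by all clients, so that their means are sums over the same index
    set and can be exchanged with the sum over clients. *)
Definition support : seq 'rV[R]_q := undup (flatten [seq data i | i <- enum 'I_N]).

Lemma mem_supportP x : reflect (exists i, x \in data i) (x \in support).
Proof.
rewrite mem_undup; apply: (iffP flatten_mapP) => [[i _ xi]|[i xi]]; first by exists i.
by exists i => //; rewrite mem_enum.
Qed.

Definition client_mean i (g : 'rV[R]_q -> R) : R :=
  \sum_(x <- support) empirical (data i) x * g x.

Lemma mean_mixture l g : mean (mixture data l) g = \sum_(i < N) l 0 i * client_mean i g.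
Proof.
rewrite /mean (fsbigE support) ?undup_uniq//; last first.
  move=> x _ xS; rewrite /mixture big1 ?mul0r// => i _.
  rewrite /empirical (count_memPn _) ?mul0r ?mulr0//.
  by apply: contra xS => xi; apply/mem_supportP; exists i.
rewrite (eq_bigl predT); last by move=> x; rewrite in_setT.
rewrite (eq_bigr (fun x => \sum_(i < N) l 0 i * (empirical (data i) x * g x))).
  by rewrite exchange_big/=; apply: eq_bigr => i _; rewrite mulr_sumr.
by move=> x _; rewrite /mixture mulr_suml; apply: eq_bigr => i _; rewrite mulrA.
Qed.

Lemma client_mean_ge0 i g : (forall x, x \in support -> 0 <= g x) -> 0 <= client_mean i g.
Proof.
move=> g0; rewrite /client_mean big_seq; apply: sumr_ge0 => x xS.
by rewrite mulr_ge0 ?empirical_ge0 ?g0.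
Qed.

(** Each weight is bounded by 1 separately; the resulting factor [size support] only affects the
    final constant. *)
Lemma client_mean_le i g M : 0 <= M ->
  (forall x, x \in support -> 0 <= g x <= M) -> client_mean i g <= (size support)%:R * M.
Proof.
move=> M0 gM; rewrite /client_mean.
apply: (@le_trans _ _ (\sum_(x <- support) M)); last first.
  by rewrite big_const_seq count_predT iter_addr_0 mulr_natl.
rewrite big_seq [leRHS]big_seq; apply: ler_sum => x /gM/andP[g0 gM'].
by rewrite (le_trans _ gM')// ler_piMl// empirical_le1.
Qed.

(** Writes the sampling error as a combination of centered indicators of the draw. When [g] depends
    on the past, the coefficients [g y] do too, and independence can be used term by term. *)
Lemma client_mean_sample i g x : x \in support ->
  client_mean i g - g x =
    - \sum_(y <- support) g y * ((y == x)%:R - empirical (data i) y).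
Proof.
move=> xS; have -> : g x = \sum_(y <- support) g y * (y == x)%:R.
  rewrite (bigD1_seq x) ?undup_uniq//= eqxx mulr1 big1 ?addr0// => y /negbTE ->.
  by rewrite mulr0.
rewrite /client_mean -sumrB -sumrN; apply: eq_bigr => y _; ring.
Qed.

End finite_mixture.

Section nonmeasurable_integral.
Context (R : realType) (d : measure_display) (Omega : measurableType d).

(* The integral of a nonnegative function is a supremum over the simple functions
   below it, hence monotone even on functions that are not measurable. *)
Lemma ge0_le_integral_nonmeasurable (mu : {measure set Omega -> \bar R})
    (f g : Omega -> \bar R) :
  (forall w, 0 <= f w)%E -> (forall w, f w <= g w)%E ->
  (\int[mu]_w f w <= \int[mu]_w g w)%E.
Proof.
move=> f0 fg; have g0 w : (0 <= g w)%E by exact: le_trans (fg w).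
rewrite !ge0_integralTE//; apply: le_ereal_sup => _ [h hf <-].
by exists h => // w; exact: le_trans (fg w).
Qed.

End nonmeasurable_integral.

(** * Convexity and regularity of the exponential risk in the model *)

Section risk.
Context (R : realType) (p q : nat) (Theta : set 'rV[R]_p) (Xi : set 'rV[R]_q).
Context (L : 'rV[R]_p -> 'rV[R]_q -> R) (c : 'rV[R]_q -> 'rV[R]_q -> R).
Context (rho beta : R) (B2 : R) (rho_gt0 : 0 < rho) (beta_gt0 : 0 < beta).
Context (L_convex : forall xi, Xi xi -> convex_function Theta (fun th => L th xi)).
Context (L_differentiable : forall th xi, Theta th -> Xi xi ->
  differentiable (fun th' => L th' xi : R^o) th).
Context (grad_bounded : forall th xi, Theta th -> Xi xi ->
  norm2 (grad (fun th' => L th' xi) th) <= B2).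
Context (Theta_convex : convex_set Theta).

Local Notation s := (rho * beta)^-1.
Local Notation pen := (penalized L c rho).
Local Notation f := (robust_loss Xi L c rho).

Definition risk th zeta := expR (f th zeta / (rho * beta)).

Lemma L_grad_le th th' xi : Theta th -> Theta th' -> Xi xi ->
  dotv (grad (fun th0 => L th0 xi) th) (th' - th) <= L th' xi - L th xi.
Proof.
by move=> Tt Tt' Xxi; apply: (grad_convex_le (L_convex Xxi)) => //; exact: L_differentiable.
Qed.

Lemma inv_rho_beta_gt0 : 0 < s.
Proof. by rewrite invr_gt0 mulr_gt0. Qed.

Variable (zeta : 'rV[R]_q) (K : R).
Hypothesis Xzeta : Xi zeta.
Hypothesis penK : forall th xi, Theta th -> Xi xi -> pen th zeta xi <= K.

Lemma has_sup_pen th : Theta th -> has_sup [set pen th zeta xi | xi in Xi].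
Proof.
move=> Tt; split; first by exists (pen th zeta zeta), zeta.
by exists K => _ [xi Xxi <-]; exact: penK.
Qed.

Lemma pen_le_robust th xi : Theta th -> Xi xi -> pen th zeta xi <= f th zeta.
Proof. by move=> Tt Xxi; apply: ub_le_sup; [exact: (has_sup_pen Tt).2|exists xi]. Qed.

Lemma robust_le th M : (forall xi, Xi xi -> pen th zeta xi <= M) -> f th zeta <= M.
Proof.
move=> h; apply: ge_sup; first by exists (pen th zeta zeta), zeta.
by move=> _ [xi Xxi <-]; exact: h.
Qed.

Lemma risk_gt0 th z : 0 < risk th z.
Proof. exact: expR_gt0. Qed.

Lemma risk_le th : Theta th -> risk th zeta <= expR (K / (rho * beta)).
Proof.
move=> Tt; rewrite ler_expR ler_wpM2r ?(ltW inv_rho_beta_gt0)//.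
by apply: robust_le => xi; exact: penK.
Qed.

(** Its role is measurability: a supremum over a possibly uncountable [Xi] is not evidently
    measurable along the iterates, whereas a Lipschitz function of them is. The gradient is taken at
    [th'], where convexity bounds the increment of [L] from above. *)
Lemma robust_lipschitz th th' : Theta th -> Theta th' ->
  f th' zeta <= f th zeta + B2 * norm2 (th' - th).
Proof.
move=> Tt Tt'; apply: robust_le => xi Xxi.
have := L_grad_le Tt' Tt Xxi; have := pen_le_robust Tt Xxi.
have := le_trans (cauchy_schwarz _ _)
  (ler_wpM2r (norm2_ge0 (th' - th)) (grad_bounded Tt' Xxi)).
by rewrite -(opprB th' th) dotvNr /penalized; lra.
Qed.

(* Convexity in [th] is used at the fixed inexact maximizer [z], so that the
   accuracy of the inner solver does not enter here. *)
Lemma risk_subgradient th th' z : Theta th -> Theta th' -> Xi z ->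
  grad_lambda L c rho beta th zeta z
    + dotv (grad_theta L c rho beta th zeta z) (th' - th) <= risk th' zeta.
Proof.
move=> Tt Tt' Xz; have := L_grad_le Tt Tt' Xz; have := pen_le_robust Tt' Xz.
rewrite /grad_theta /grad_lambda /risk dotvZl.
set a := pen th zeta z / _; set g := dotv _ _ => h1 h2.
have h3 : a + g / (rho * beta) <= f th' zeta / (rho * beta).
  rewrite /a -mulrDl ler_wpM2r ?(ltW inv_rho_beta_gt0)//; move: h1 h2; rewrite /penalized; lra.
have := expR_ge1Dx (f th' zeta / (rho * beta) - a).
have -> : expR (f th' zeta / (rho * beta)) =
   expR a * expR (f th' zeta / (rho * beta) - a) by rewrite -expRD addrC subrK.
move=> /(ler_wpM2l (expR_ge0 a)); apply: le_trans.
rewrite -mulrA -{1}(mulr1 (expR a)) -mulrDr ler_wpM2l ?expR_ge0//.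
by rewrite lerD2l lerBrDl mulrC.
Qed.

Lemma norm2_grad_theta_le th z : Theta th -> Xi z ->
  norm2 (grad_theta L c rho beta th zeta z) <= expR (K / (rho * beta)) / (rho * beta) * B2.
Proof.
move=> Tt Xz; rewrite norm2Z ger0_norm; last first.
  by rewrite mulr_ge0 ?expR_ge0// ltW// inv_rho_beta_gt0.
rewrite ler_pM ?norm2_ge0 ?grad_bounded//.
  by rewrite mulr_ge0 ?expR_ge0// ltW// inv_rho_beta_gt0.
by rewrite ler_wpM2r ?(ltW inv_rho_beta_gt0)// ler_expR ler_wpM2r ?(ltW inv_rho_beta_gt0)// penK.
Qed.

(** Gradient inequalities at the average [b] replace a many-point Jensen inequality. For [L] at each
    [xi] the linear terms cancel, as the deviations from [b] sum to zero; taking the supremum gives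
    [avg_f]. For [expR], tangent at [f b zeta], the linear terms have nonnegative sum by [avg_f]. *)
Lemma risk_jensen (th : nat -> 'rV[R]_p) (T : nat) : (0 < T)%N ->
  (forall t, (1 <= t <= T)%N -> Theta (th t)) ->
  risk (T%:R^-1 *: \sum_(1 <= t < T.+1) th t) zeta
    <= T%:R^-1 * \sum_(1 <= t < T.+1) risk (th t) zeta.
Proof.
move=> T0 Tth; have Tb := convex_set_average Theta_convex T0 Tth.
set b := _ *: _ in Tb *.
have T0' : 0 < T%:R :> R by rewrite ltr0n.
have sumT : \sum_(1 <= t < T.+1) b = T%:R *: b.
  by rewrite sumr_const_nat subn1 scaler_nat.
have sum0 : \sum_(1 <= t < T.+1) (th t - b) = 0.
  by rewrite sumrB sumT /b scalerA divff ?gt_eqF// scale1r subrr.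
have avg_f : f b zeta <= T%:R^-1 * \sum_(1 <= t < T.+1) f (th t) zeta.
  apply: robust_le => xi Xxi; rewrite -(ler_pM2l T0') mulrA divff ?gt_eqF// mul1r.
  have : \sum_(1 <= t < T.+1) (pen b zeta xi +
      dotv (grad (fun th0 => L th0 xi) b) (th t - b)) <= \sum_(1 <= t < T.+1) f (th t) zeta.
    apply: ler_sum_nat => t tT; have Tt := Tth _ tT.
    apply: le_trans (pen_le_robust Tt Xxi).
    by have := L_grad_le Tb Tt Xxi; rewrite /penalized; lra.
  rewrite big_split/= sumr_const_nat subn1 mulr_natl.
  rewrite (eq_bigr (fun t => dotv (th t - b) (grad (fun th0 => L th0 xi) b))).
    by rewrite -dotv_suml sum0 -(scale0r 0) dotvZl mul0r addr0.
  by move=> t _; rewrite dotvC.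
rewrite -(ler_pM2l T0') mulrA divff ?gt_eqF// mul1r.
have : \sum_(1 <= t < T.+1) (risk b zeta * (1 - f b zeta / (rho * beta))
     + risk b zeta * s * f (th t) zeta) <= \sum_(1 <= t < T.+1) risk (th t) zeta.
  apply: ler_sum_nat => t tT.
  rewrite /risk; set u := f b zeta; set v := f (th t) zeta.
  have -> : expR (v / (rho * beta)) =
     expR (u / (rho * beta)) * expR (v / (rho * beta) - u / (rho * beta)).
    by rewrite -expRD addrC subrK.
  have := ler_wpM2l (expR_ge0 (u / (rho * beta)))
    (expR_ge1Dx (v / (rho * beta) - u / (rho * beta))).
  lra.
apply: le_trans; rewrite big_split/= sumr_const_nat subn1 -mulr_sumr -mulr_natl.
rewrite -(ler_pM2l T0') mulrA divff ?gt_eqF// mul1r in avg_f.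
have := ler_wpM2l (mulr_ge0 (ltW (risk_gt0 b zeta)) (ltW inv_rho_beta_gt0)) avg_f.
lra.
Qed.

End risk.

(** * Runs of the algorithm *)

Section adapted.
Context (R : realType) (d : measure_display) (Omega : measurableType d).
Context (G : set (set Omega)) (Galg : sigma_algebra setT G).
Implicit Types (h : Omega -> R).

Lemma measurable_fun_rays h : (forall a, G [set w | h w < a]) ->
  measurable_fun [set: g_sigma_algebraType G] (h : g_sigma_algebraType G -> R).
Proof.
move=> hG; apply: (measurability _ (RGenInftyO.measurableE R)) => _ [_ [a ->] <-].
rewrite setTI; apply: sub_sigma_algebra.
by rewrite (_ : _ @^-1` _ = [set w | h w < a])//; apply/seteqP; split => w /=; rewrite in_itv.
Qed.

Lemma measurable_wrt_coord (n : nat) (X : Omega -> 'rV[R]_n) i : measurable_wrt G X ->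
  measurable_fun [set: g_sigma_algebraType G]
    ((fun w => X w 0 i) : g_sigma_algebraType G -> R).
Proof.
move=> mX; apply: measurable_fun_rays => a.
rewrite (_ : [set w | _] = X @^-1` ((fun u : 'rV[R]_n => u 0 i) @^-1` [set r | r < a]))//.
by apply: mX; apply: open_comp; [move=> u _; exact: coord_continuous|exact: open_lt].
Qed.

(** On [S], [f] agrees with its Lipschitz extension, the infimum over [x] in [S] of
    [f x + B * norm2 (y - x)]. The strict sublevel sets of the extension are the unions [U] of open
    sets, so [S] itself need not be measurable. *)
Lemma measurable_wrt_lipschitz (n : nat) (S : set 'rV[R]_n) (X : Omega -> 'rV[R]_n)
    (f : 'rV[R]_n -> R) (B : R) :
  measurable_wrt G X -> (forall w, S (X w)) ->
  (forall x y, S x -> S y -> f y <= f x + B * norm2 (y - x)) ->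
  measurable_fun [set: g_sigma_algebraType G]
    ((fun w => f (X w)) : g_sigma_algebraType G -> R).
Proof.
move=> mX SX fB; apply: measurable_fun_rays => a.
pose U := \bigcup_(x in S) ((fun y => f x + B * norm2 (y - x)) @^-1` [set r | r < a]).
rewrite (_ : [set w | _] = X @^-1` U); last first.
  apply/seteqP; split => w /=; last by move=> [x Sx /=]; apply: le_lt_trans; exact: fB.
  by move=> fa; exists (X w) => //=; rewrite subrr norm20 mulr0 addr0.
have affine x : continuous (fun r : R => f x + B * r).
  move=> r; apply: (@cvgD _ _ _ _ _ (fun=> f x) (fun r => B * r)); first exact: cvg_cst.
  by apply: (@cvgM _ _ _ _ (fun=> B) id) => //; exact: cvg_cst.
have dist_cont x : continuous (fun y : 'rV[R]_n => norm2 (y - x)).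
  move=> y; apply: (@continuous_comp _ _ _ (fun y : 'rV[R]_n => y - x));
      last exact: continuous_norm2.
    by apply: (@continuousB _ _ _ _ (cst x)); [move=> ?|exact: cst_continuous].
have bound_cont x : continuous (fun y : 'rV[R]_n => f x + B * norm2 (y - x)).
  move=> y.
  by apply: (@continuous_comp _ _ _ (fun y : 'rV[R]_n => norm2 (y - x))
    (fun r : R => f x + B * r)); [exact: dist_cont|exact: affine].
apply: mX; apply: bigcup_open => x _; apply: open_comp; last exact: open_lt.
by move=> y _; exact: bound_cont.
Qed.

Lemma measurable_wrt_singleton (n : nat) (X : Omega -> 'rV[R]_n) x :
  measurable_wrt G X -> G (X @^-1` [set x]).
Proof.
move=> mX; rewrite -(setCK [set x]) preimage_setC -setTD.
case: Galg => _ GC _; apply: (GC (X @^-1` ~` [set x])).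
apply: mX; apply: closed_openC.
exact: accessible_closed_set1 (hausdorff_accessible (@norm_hausdorff _ _)) x.
Qed.

End adapted.

(** * Sampling error of one client in one round, with [G] the information before the draw and [G']
    after it *)

Section sampling_noise.
Context (R : realType) (d : measure_display) (Omega : measurableType d).
Context (P : probability Omega R) (q N : nat) (data : 'I_N -> seq 'rV[R]_q).
Context (G G' : set (set Omega)) (Galg : sigma_algebra setT G).
Hypothesis Gmeas : forall A, G A -> measurable A.
Hypothesis G'meas : forall A, G' A -> measurable A.
Hypothesis GG' : G `<=` G'.
Context (i : 'I_N) (zeta : Omega -> 'rV[R]_q).
Hypothesis zeta_data : forall w, zeta w \in data i.
Hypothesis zeta_adapted : forall x, G' (zeta @^-1` [set x]).
Hypothesis zeta_law : forall x A, G A ->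
  P (A `&` zeta @^-1` [set x]) = (P A * (empirical (data i) x)%:E)%E.
Context (h : 'rV[R]_q -> Omega -> R).
Hypothesis bh : forall x, x \in support data -> bmeas G (h x).

Let noise_expand w : client_mean data i (h^~ w) - h (zeta w) w =
  \sum_(y <- support data)
    (-1 * h y w) * (\1_(zeta @^-1` [set y]) w - empirical (data i) y).
Proof.
have zS : zeta w \in support data by apply/mem_supportP; exists i.
rewrite (client_mean_sample i _ zS) -sumrN; apply: eq_bigr => y _.
rewrite mulN1r mulNr indicE; congr (- (_ * (_%:R - _))); congr (nat_of_bool _).
apply/eqP/idP => [->|]; first by rewrite inE.
by rewrite inE.
Qed.

Let bindic x : bmeas G' (fun w => \1_(zeta @^-1` [set x]) w - empirical (data i) x).
Proof. by apply: bmeasB; [exact: bmeas_indic|exact: bmeas_cst]. Qed.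

Lemma sampling_noise_bmeas :
  bmeas G' (fun w => client_mean data i (h^~ w) - h (zeta w) w).
Proof.
under eq_fun do rewrite noise_expand.
apply: bmeas_sum => y yS; apply: bmeasM; last exact: bindic.
by apply: (bmeasS GG'); apply: bmeasZ; exact: bh.
Qed.

(** After [noise_expand] every term is a [G]-measurable coefficient times a centered indicator of
    the draw, which is independent of [G]. *)
Lemma sampling_noise_centered Y : bmeas G Y ->
  \int[P]_w (Y w * (client_mean data i (h^~ w) - h (zeta w) w)) = 0.
Proof.
move=> bY; under eq_Rintegral do rewrite noise_expand mulr_sumr.
have bYh y : y \in support data -> bmeas G (fun w => Y w * (-1 * h y w)).
  by move=> yS; apply: bmeasM => //; apply: bmeasZ; exact: bh.
rewrite (Rintegral_bmeas_sum _ G'meas); last first.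
  move=> y yS; rewrite (_ : (fun _ => _) = fun w => (Y w * (-1 * h y w)) *
    (\1_(zeta @^-1` [set y]) w - empirical (data i) y)).
    by apply: bmeasM; [exact: bmeasS GG' (bYh _ yS)|exact: bindic].
  by apply/funext => w; rewrite mulrA.
rewrite big_seq big1// => y yS.
under eq_Rintegral do rewrite mulrA.
apply: (@Rintegral_indep _ _ _ _ G) => //.
- exact: G'meas.
- exact: empirical_ge0.
- exact: bYh.
- by move=> B; rewrite sigma_algebra_id// => GB; exact: zeta_law.
Qed.

End sampling_noise.

Section data_bounds.
Context (R : realType) (p q N : nat) (Theta : set 'rV[R]_p) (Xi : set 'rV[R]_q).
Context (L : 'rV[R]_p -> 'rV[R]_q -> R) (c : 'rV[R]_q -> 'rV[R]_q -> R).
Context (rho B1 Lxi : R) (data : 'I_N -> seq 'rV[R]_q).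

(** For a fixed data point the functions [penalized] form a strongly concave family indexed by [th],
    to which [concave_family_bounds] applies; the constants of the finitely many data points are
    added. *)
Lemma uniform_data_bounds :
  0 < rho ->
  (forall i zeta, zeta \in data i -> Xi zeta) ->
  (forall th, Theta th -> concave_function Xi (L th)) ->
  (forall th xi, Theta th -> Xi xi -> `|L th xi| <= B1) ->
  (forall zeta, Xi zeta -> strongly_convex_function Xi (fun xi => c xi zeta)) ->
  (forall th zeta xi, Theta th -> Xi zeta -> Xi xi ->
       differentiable (fun xi' => penalized L c rho th zeta xi' : R^o) xi) ->
  (forall th zeta xi1 xi2, Theta th -> Xi zeta -> Xi xi1 -> Xi xi2 ->
       norm2 (grad (penalized L c rho th zeta) xi1
              - grad (penalized L c rho th zeta) xi2) <= Lxi * norm2 (xi1 - xi2)) ->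
  exists2 K, 0 <= K & forall zeta, zeta \in support data -> forall th, Theta th ->
    (forall x, Xi x -> penalized L c rho th zeta x <= K) /\
    (forall x z, argmax_set Xi (penalized L c rho th zeta) x -> Xi z ->
       penalized L c rho th zeta x - penalized L c rho th zeta z
         <= K * (1 + norm2 (z - x)) * norm2 (z - x)).
Proof.
move=> rho0 dataXi Lconc LB1 cstr dpen smooth.
have one zeta : zeta \in support data -> exists2 K, 0 <= K & forall th, Theta th ->
    (forall x, Xi x -> penalized L c rho th zeta x <= K) /\
    (forall x z, argmax_set Xi (penalized L c rho th zeta) x -> Xi z ->
       penalized L c rho th zeta x - penalized L c rho th zeta z
         <= K * (1 + norm2 (z - x)) * norm2 (z - x)).
  move=> /mem_supportP[i /dataXi Xz]; have [mu mu0 cmu] := cstr _ Xz.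
  (* The base point is the data point itself. The cost cancels in differences over [th], which
     leaves [2 * |B1|]; absolute values are taken because [B1] and [Lxi] carry no sign
     assumption. *)
  apply: (@concave_family_bounds _ _ _ Theta (fun th => penalized L c rho th zeta) Xi zeta
    (rho * mu) (2 * `|B1|) `|Lxi|) => //.
  - exact: mulr_gt0.
  - move=> th x y t Tt Xx Xy t01; have := cmu y x t Xy Xx t01.
    have := convex_function_conv (Lconc _ Tt) Xy Xx t01.
    move=> h1 /(ler_wpM2l (ltW rho0)); move: h1; rewrite /penalized; lra.
  - by move=> th x Tt Xx; exact: dpen.
  - move=> th x y Tt Xx Xy; apply: le_trans (smooth _ _ _ _ Tt Xz Xx Xy) _.
    by rewrite ler_wpM2r ?norm2_ge0// ler_norm.
  - move=> th th' x Tt Tt' Xx; have := LB1 _ _ Tt Xx; have := LB1 _ _ Tt' Xx.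
    have := ler_norm (L th x); have := ler_norm (- L th' x); rewrite normrN /penalized.
    have := ler_norm B1; lra.
elim: (support data) one => [|zeta r IH] one; first by exists 0.
have [z zr|K K0 KP] := IH; first by apply: one; rewrite inE zr orbT.
have [K' K'0 K'P] := one zeta (mem_head _ _).
exists (K + K'); first exact: addr_ge0.
have step th k z : k <= K + K' ->
    (forall x, Xi x -> penalized L c rho th z x <= k) /\
    (forall x y, argmax_set Xi (penalized L c rho th z) x -> Xi y ->
       penalized L c rho th z x - penalized L c rho th z y
         <= k * (1 + norm2 (y - x)) * norm2 (y - x)) ->
    (forall x, Xi x -> penalized L c rho th z x <= K + K') /\
    (forall x y, argmax_set Xi (penalized L c rho th z) x -> Xi y ->
       penalized L c rho th z x - penalized L c rho th z y
         <= (K + K') * (1 + norm2 (y - x)) * norm2 (y - x)).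
  move=> kK [h1 h2]; split => [x Xx|x y mx Xy]; first exact: le_trans (h1 x Xx) _.
  apply: le_trans (h2 x y mx Xy) _.
  by rewrite !ler_wpM2r ?addr_ge0 ?norm2_ge0.
move=> z; rewrite inE => /predU1P[->|zr] th Tt.
  by apply: (step _ K'); [rewrite lerDr|exact: K'P].
by apply: (step _ K); [rewrite lerDl|exact: KP].
Qed.

End data_bounds.

Lemma simplex_convex (R : realType) (N : nat) : convex_set (simplex R N).
Proof.
move=> x y t /set_mem[x0 x1] /set_mem[y0 y1]; apply/mem_set.
have t1 : 0 <= 1 - t%:num by rewrite subr_ge0.
split.
  by move=> i; rewrite !mxE; apply: addr_ge0; apply: mulr_ge0.
transitivity (\sum_(i < N) (t%:num * x 0 i + (1 - t%:num) * y 0 i)).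
  by apply: eq_bigr => i _; rewrite !mxE.
by rewrite big_split/= -!mulr_sumr x1 y1 !mulr1 addrC subrK.
Qed.

Lemma simplex_le1 (R : realType) (N : nat) (l : 'rV[R]_N) i : simplex R N l -> l 0 i <= 1.
Proof. by move=> [l0 <-]; rewrite (bigD1 i)//= lerDl sumr_ge0. Qed.

(** Read [r] as the square root of the horizon [t] and [r^-1] as the step size. The right side
    exceeds the left by exactly [r * m + r ^+ 2 * (X * e)], with [X] as in the proof. *)
Lemma balanced_step_rate (R : realType) (n a Dt Gt Dl Gl m W e r t : R) :
  0 < r -> t = r ^+ 2 -> 0 <= n -> 0 <= a -> 0 <= Dt -> 0 <= Gt -> 0 <= Dl -> 0 <= Gl ->
  0 <= m -> 0 <= e ->
  n * (r^-1 / 2 * (t * a)) + (n * (r / 2) + (Dt / (2 * r^-1) + t * (r^-1 * Gt / 2))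
    + (Dl / (2 * r^-1) + t * (r^-1 * Gl / 2)) + t * (m * e) + t * W)
  <= t * (W + (n * (a + 1) / 2 + (Dt + Gt) / 2 + (Dl + Gl) / 2 + m) * (r^-1 + e)).
Proof.
move=> r0 -> n0 a0 Dt0 Gt0 Dl0 Gl0 m0 e0.
set X := n * (a + 1) / 2 + (Dt + Gt) / 2 + (Dl + Gl) / 2.
have X0 : 0 <= X by rewrite !addr_ge0// divr_ge0 ?mulr_ge0 ?addr_ge0.
rewrite -subr_ge0 (_ : _ - _ = r * m + r ^+ 2 * (X * e)).
  by rewrite addr_ge0// mulr_ge0 ?exprn_ge0 ?mulr_ge0// ltW.
by rewrite /X; field; rewrite gt_eqF.
Qed.

Section run.
Context (R : realType) (p q N : nat)
    (Theta : set 'rV[R]_p) (Xi : set 'rV[R]_q)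
    (L : 'rV[R]_p -> 'rV[R]_q -> R) (c : 'rV[R]_q -> 'rV[R]_q -> R)
    (rho beta : R) (data : 'I_N -> seq 'rV[R]_q)
    (Dtheta Dlambda B2 K : R).
Context (rho_gt0 : 0 < rho) (beta_gt0 : 0 < beta).
Context (data_Xi : forall i zeta, zeta \in data i -> Xi zeta).
Context (Theta_convex : convex_set Theta).
Context (L_convex : forall xi, Xi xi -> convex_function Theta (fun th => L th xi)).
Context (Theta_bounded : forall th1 th2, Theta th1 -> Theta th2 ->
       norm2 (th1 - th2) <= Dtheta).
Context (simplex_bounded : forall l1 l2, simplex R N l1 -> simplex R N l2 ->
       norm2 (l1 - l2) <= Dlambda).
Context (L_differentiable : forall th xi, Theta th -> Xi xi ->
       differentiable (fun th' => L th' xi : R^o) th).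
Context (grad_bounded : forall th xi, Theta th -> Xi xi ->
       norm2 (grad (fun th' => L th' xi) th) <= B2).
Context (K_ge0 : 0 <= K).
Hypothesis uniform_bounds : forall zeta, zeta \in support data -> forall th, Theta th ->
    (forall x, Xi x -> penalized L c rho th zeta x <= K) /\
    (forall x z, argmax_set Xi (penalized L c rho th zeta) x -> Xi z ->
       penalized L c rho th zeta x - penalized L c rho th zeta z
         <= K * (1 + norm2 (z - x)) * norm2 (z - x)).

Local Notation riskf := (risk Xi L c rho beta).
Local Notation worst := (worst_case Xi L c rho beta data).
Local Notation sb := (rho * beta)^-1.

(** [M] bounds every risk and every [grad_lambda], [Merr] is the factor of [eps] in the inner error,
    [Gtheta] and [Glambda] bound the two players' gradients (the latter through the sum of absolute
    coordinates), and [Mmean] bounds the client means. *)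
Let M := expR (K / (rho * beta)).
Let Merr := expR (sb * K) * (1 + 3 * sb * K).
Let Gtheta := M / (rho * beta) * B2.
Let Glambda := N%:R * M.
Let Mmean := (size (support data))%:R * M.

Let M_ge0 : 0 <= M. Proof. exact: expR_ge0. Qed.

Let Mmean_ge0 : 0 <= Mmean. Proof. exact: mulr_ge0. Qed.

Let support_Xi zeta : zeta \in support data -> Xi zeta.
Proof. by move=> /mem_supportP[i]; exact: data_Xi. Qed.

Let penK zeta : zeta \in support data ->
  forall th x, Theta th -> Xi x -> penalized L c rho th zeta x <= K.
Proof. by move=> zS th x Tt; exact: (uniform_bounds zS Tt).1. Qed.

Let risk_bounds th zeta : Theta th -> zeta \in support data -> 0 <= riskf th zeta <= M.
Proof.
move=> Tt zS; rewrite expR_ge0/=.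
exact: (risk_le rho_gt0 beta_gt0 (support_Xi zS) (penK zS)).
Qed.

Lemma objectiveE th l : objective Xi L c rho beta data th l =
  \sum_(i < N) l 0 i * client_mean data i (riskf th).
Proof. by rewrite /objective mean_mixture. Qed.

Lemma client_mean_bounds th i : Theta th -> 0 <= client_mean data i (riskf th) <= Mmean.
Proof.
move=> Tt; rewrite client_mean_ge0/=; last by move=> x /(risk_bounds Tt)/andP[].
by apply: client_mean_le => // x; exact: risk_bounds.
Qed.

Lemma objective_le_worst th l : Theta th -> simplex R N l ->
  \sum_(i < N) l 0 i * client_mean data i (riskf th) <= worst th.
Proof.
move=> Tt Sl; apply: ub_le_sup; last by exists l => //; exact: objectiveE.
exists Mmean => _ [l' [l'0 l'1] <-]; rewrite objectiveE.
rewrite -[leRHS]mul1r -l'1 mulr_suml; apply: ler_sum => i _.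
by rewrite ler_wpM2l//; case/andP: (client_mean_bounds i Tt).
Qed.

(** A point of the simplex is required because for [N = 0] the simplex is empty and [sup] takes its
    default value. *)
Lemma worst_case_le th B : (exists l, simplex R N l) ->
  (forall l, simplex R N l -> \sum_(i < N) l 0 i * client_mean data i (riskf th) <= B) ->
  worst th <= B.
Proof.
move=> [l Sl] h; apply: ge_sup; first by exists (objective Xi L c rho beta data th l), l.
by move=> _ [l' Sl' <-]; rewrite objectiveE; exact: h.
Qed.

Lemma worst_case_ge0 th : (exists l, simplex R N l) -> Theta th -> 0 <= worst th.
Proof.
move=> [l Sl] Tt; apply: le_trans (objective_le_worst Tt Sl).
apply: sumr_ge0 => i _; rewrite mulr_ge0//; first by case: Sl.
by case/andP: (client_mean_bounds i Tt).
Qed.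

Context (T : nat) (eps eta : R) (d : measure_display) (Omega : measurableType d)
  (P : probability Omega R) (F : nat -> set (set Omega))
  (theta : nat -> Omega -> 'rV[R]_p) (lambda : nat -> Omega -> 'rV[R]_N)
  (zeta z : 'I_N -> nat -> Omega -> 'rV[R]_q).
Context (eps_ge0 : 0 <= eps) (eta_gt0 : 0 < eta).
Hypothesis hrun : dorfl_run Theta Xi L c rho beta data T eps eta eta P F theta lambda zeta z.

Lemma theta_in t w : (1 <= t <= T.+1)%N -> Theta (theta t w).
Proof.
case: t => [//|[|t]] tT; first by case: (run_init hrun w).
exact: (run_theta_step hrun (t := t.+1) w tT).1.
Qed.

Lemma lambda_in t w : (1 <= t <= T.+1)%N -> simplex R N (lambda t w).
Proof.
case: t => [//|[|t]] tT; first by case: (run_init hrun w).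
exact: (run_lambda_step hrun (t := t.+1) w tT).1.
Qed.

Let leqT1 t : (1 <= t <= T)%N -> (1 <= t <= T.+1)%N.
Proof. by move=> /andP[-> tT]; rewrite ltnW. Qed.

Let zeta_support i t w : (1 <= t <= T)%N -> zeta i t w \in support data.
Proof. by move=> tT; apply/mem_supportP; exists i; exact: run_sample hrun i t w tT. Qed.

(** The two linear regrets add up so that the values [gl] cancel: the [lambda] regret contributes
    [l - lambda] paired with [gl], the subgradient inequality bounds the [lambda] part by the
    comparator's risk, and the inner error turns the [l] part into the risk of the iterate. *)
Lemma pathwise_regret w th l : Theta th -> simplex R N l ->
  \sum_(1 <= t < T.+1) \sum_(i < N) l 0 i * riskf (theta t w) (zeta i t w)
  - \sum_(1 <= t < T.+1) \sum_(i < N) lambda t w 0 i * riskf th (zeta i t w)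
  <= (Dtheta ^+ 2 / (2 * eta) + T%:R * (eta * Gtheta ^+ 2 / 2))
     + (Dlambda ^+ 2 / (2 * eta) + T%:R * (eta * Glambda ^+ 2 / 2))
     + T%:R * (Merr * eps).
Proof.
move=> Tth Sl.
pose gt i t := grad_theta L c rho beta (theta t w) (zeta i t w) (z i t w).
pose gl i t := grad_lambda L c rho beta (theta t w) (zeta i t w) (z i t w).
have Xz i t : (1 <= t <= T)%N -> Xi (z i t w) by move=> tT; case: (run_inner hrun i w tT).
have reg_theta : \sum_(1 <= t < T.+1) dotv (\sum_(i < N) lambda t w 0 i *: gt i t)
    (theta t w - th) <= Dtheta ^+ 2 / (2 * eta) + T%:R * (eta * Gtheta ^+ 2 / 2).
  apply: (@projected_gradient_regret _ _ Theta (fun t => theta t w)) => //.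
  (* Since the weights sum to one, averaging the clients' local steps is a single step from
     [theta t w] along the weighted gradient. *)
  - move=> t tT; have [_ l1] := lambda_in w (leqT1 tT).
    have := run_theta_step hrun w tT; congr (is_proj _ _ _).
    under eq_bigr do rewrite scalerBr.
    rewrite sumrB -scaler_suml l1 scale1r scaler_sumr; congr (_ - _).
    by apply: eq_bigr => i _; rewrite [LHS]scalerA [RHS]scalerA mulrC.
  - move=> t tT; have [l0 l1] := lambda_in w (leqT1 tT).
    apply: le_trans (norm2_sum _ _) _; rewrite -[leRHS]mul1r -l1 mulr_suml.
    apply: ler_sum => i _; rewrite norm2Z ger0_norm// ler_wpM2l//.
    have zS := zeta_support i w tT.
    apply: (norm2_grad_theta_le rho_gt0 beta_gt0 grad_bounded (penK zS)).
      exact: theta_in (leqT1 tT).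
    exact: Xz.
  - by apply: Theta_bounded => //; exact: theta_in.
have reg_lambda : \sum_(1 <= t < T.+1) dotv (- \row_(i < N) gl i t) (lambda t w - l)
    <= Dlambda ^+ 2 / (2 * eta) + T%:R * (eta * Glambda ^+ 2 / 2).
  apply: (@projected_gradient_regret _ _ (simplex R N) (fun t => lambda t w)) => //.
  - exact: simplex_convex.
  - by move=> t tT; have := run_lambda_step hrun w tT; rewrite scalerN opprK.
  - move=> t tT; rewrite norm2N; apply: le_trans (norm2_le_sum _) _.
    rewrite /Glambda -[N in N%:R]card_ord mulr_natl -sumr_const; apply: ler_sum => i _.
    rewrite mxE ger0_norm ?expR_ge0// ler_expR ler_wpM2r ?(ltW (inv_rho_beta_gt0 _ _))//.
    by apply: penK; [exact: zeta_support|exact: theta_in (leqT1 tT)|exact: Xz].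
  - by apply: simplex_bounded => //; exact: lambda_in.
apply: le_trans (lerD (lerD reg_theta reg_lambda) (lexx _)).
rewrite -sumrB -big_split/=.
rewrite (_ : T%:R * _ = \sum_(1 <= t < T.+1) Merr * eps); last first.
  by rewrite sumr_const_nat subn1 mulr_natl.
rewrite -big_split/=; apply: ler_sum_nat => t; rewrite ltnS => tT.
have [l0 l1] := Sl; have [lt0 lt1] := lambda_in w (leqT1 tT).
have Tt := theta_in w (leqT1 tT).
(* The error [Merr * eps] is spread over the clients with the weights [l], which reduces the claim
   to one inequality per client and round. *)
rewrite dotv_suml [dotv (- _) _]/dotv -[Merr * eps]mul1r -l1 mulr_suml -!big_split/= -sumrB.
apply: ler_sum => i _; rewrite !mxE dotvZl.
have zS := zeta_support i w tT.
have := risk_subgradient rho_gt0 beta_gt0 L_convex L_differentiable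
  (support_Xi zS) (penK zS) Tt Tth (Xz i t tT).
rewrite -(opprB (theta t w)) dotvNr -/(gt i t) -/(gl i t) => /(ler_wpM2l (lt0 i)).
have [_ dz] := run_inner hrun i w tT.
have := inner_error_bound (ltW (inv_rho_beta_gt0 rho_gt0 beta_gt0)) K_ge0 eps_ge0
  (fun x => penK zS Tt) (uniform_bounds zS Tt).2 (Xz i t tT) dz.
rewrite ![sb * _]mulrC -/(riskf (theta t w) (zeta i t w))
  -[expR (penalized _ _ _ _ _ _ / _)]/(gl i t)
  => /(ler_wpM2l (l0 i)).
rewrite /Merr ![sb * K]mulrC.
lra.
Qed.

Let E (Y : Omega -> R) := \int[P]_w Y w.

Let gap i t w := client_mean data i (riskf (theta t w)) - riskf (theta t w) (zeta i t w).

Let Fmeas t A : F t A -> measurable A.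
Proof. by case: (run_filtration hrun) => _ Fm _; exact: Fm. Qed.

Let Fmono s t : (s <= t)%N -> F s `<=` F t.
Proof. by case: (run_filtration hrun) => _ _; apply. Qed.

Let Falg t : sigma_algebra setT (F t).
Proof. by case: (run_filtration hrun). Qed.

Let zeta_F i t x : (1 <= t <= T)%N -> F t.+1 (zeta i t @^-1` [set x]).
Proof.
by move=> tT; apply: measurable_wrt_singleton => //; exact: run_zeta_adapted hrun i t tT.
Qed.

Lemma risk_bmeas t x : (1 <= t <= T)%N -> x \in support data ->
  bmeas (F t) (fun w => riskf (theta t w) x).
Proof.
move=> tT xS; split; last first.
  exists M => w; rewrite ger0_norm ?expR_ge0//.
  by case/andP: (risk_bounds (theta_in w (leqT1 tT)) xS).
apply: (@measurableT_comp _ _ _ _ _ _ expR); first exact: measurable_expR.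
apply: (measurable_funM _ (measurable_cst _)).
apply: (@measurable_wrt_lipschitz _ _ _ _ _ Theta _
  (fun th => robust_loss Xi L c rho th x) B2).
- exact: run_theta_adapted hrun t tT.
- by move=> w; exact: theta_in (leqT1 tT).
- by move=> th th' Tt Tt'; exact: (robust_lipschitz L_convex L_differentiable grad_bounded
    (support_Xi xS) (penK xS)).
Qed.

Lemma lambda_bmeas t i : (1 <= t <= T)%N -> bmeas (F t) (fun w => lambda t w 0 i).
Proof.
move=> tT; split; first by apply: measurable_wrt_coord; exact: run_lambda_adapted hrun t tT.
exists 1 => w; have Sl := lambda_in w (leqT1 tT).
by rewrite ger0_norm ?simplex_le1//; case: Sl.
Qed.

Lemma gap_bmeas i t : (1 <= t <= T)%N -> bmeas (F t.+1) (gap i t).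
Proof.
move=> tT; apply: (@sampling_noise_bmeas _ _ _ _ _ data (F t) (F t.+1) _ i (zeta i t) _ _
  (fun x w => riskf (theta t w) x)).
- exact: Fmono.
- by move=> w; exact: run_sample hrun i t w tT.
- by move=> x; exact: zeta_F.
- by move=> x; exact: risk_bmeas.
Qed.

Lemma gap_centered i t Y : (1 <= t <= T)%N -> bmeas (F t) Y ->
  E (fun w => Y w * gap i t w) = 0.
Proof.
move=> tT; apply: (@sampling_noise_centered _ _ _ _ _ _ data (F t) (F t.+1) _ _ _ _ i
  (zeta i t) _ _ _ (fun x w => riskf (theta t w) x)).
- exact: Falg.
- exact: Fmeas.
- exact: Fmeas.
- exact: Fmono.
- by move=> w; exact: run_sample hrun i t w tT.
- by move=> x; exact: zeta_F.
- by move=> x A; exact: run_sample_law hrun i t x A tT.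
- by move=> x; exact: risk_bmeas.
Qed.

Lemma gap_second_moment i :
  E (fun w => (\sum_(1 <= t < T.+1) gap i t w) ^+ 2) <= T%:R * (Mmean + M) ^+ 2.
Proof.
apply: (@martingale_second_moment _ _ _ _ F) => //.
- exact: gap_bmeas.
- move=> t w tT; have Tt := theta_in w (leqT1 tT).
  have /andP[h1 h2] := client_mean_bounds i Tt.
  have /andP[h3 h4] := risk_bounds Tt (zeta_support i w tT).
  by rewrite /gap ler_norml; apply/andP; split; lra.
- exact: gap_centered.
Qed.

Lemma comparator_noise_bmeas th i t : (1 <= t <= T)%N ->
  bmeas (F t.+1) (fun w => client_mean data i (riskf th) - riskf th (zeta i t w)).
Proof.
move=> tT; apply: (@sampling_noise_bmeas _ _ _ _ _ data (F t) (F t.+1) _ i (zeta i t) _ _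
  (fun x w => riskf th x)).
- exact: Fmono.
- by move=> w; exact: run_sample hrun i t w tT.
- by move=> x; exact: zeta_F.
- by move=> x _; exact: bmeas_cst.
Qed.

Lemma comparator_noise_centered th i t Y : (1 <= t <= T)%N -> bmeas (F t) Y ->
  E (fun w => Y w * (client_mean data i (riskf th) - riskf th (zeta i t w))) = 0.
Proof.
move=> tT; apply: (@sampling_noise_centered _ _ _ _ _ _ data (F t) (F t.+1) _ _ _ _ i
  (zeta i t) _ _ _ (fun x w => riskf th x)).
- exact: Falg.
- exact: Fmeas.
- exact: Fmeas.
- exact: Fmono.
- by move=> w; exact: run_sample hrun i t w tT.
- by move=> x; exact: zeta_F.
- by move=> x A; exact: run_sample_law hrun i t x A tT.
- by move=> x _; exact: bmeas_cst.
Qed.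

(** A majorant free of the maximizing weights and of the inner points: squared noise of each client,
    the comparator's noise, and a deterministic remainder. *)
Let bound th (r : R) w :=
  \sum_(i < N) (r^-1 / 2 * (\sum_(1 <= t < T.+1) gap i t w) ^+ 2)
  + (-1 * (\sum_(1 <= t < T.+1) \sum_(i < N)
        lambda t w 0 i * (client_mean data i (riskf th) - riskf th (zeta i t w)))
    + (N%:R * (r / 2)
       + (Dtheta ^+ 2 / (2 * eta) + T%:R * (eta * Gtheta ^+ 2 / 2))
       + (Dlambda ^+ 2 / (2 * eta) + T%:R * (eta * Glambda ^+ 2 / 2))
       + T%:R * (Merr * eps) + T%:R * worst th)).

(* AM-GM with weight [r] trades the linear noise of client [i] for its square, whose
   expectation is controlled; the choice [r = sqrt T] balances the two terms. *)
Lemma average_worst_le th r w : (0 < T)%N -> 0 < r -> Theta th ->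
  T%:R * worst (average_iterate T theta w) <= bound th r w.
Proof.
move=> T0 r0 Tth; have T0' : 0 < T%:R :> R by rewrite ltr0n.
have lambda1 := lambda_in w (isT : (1 <= 1 <= T.+1)%N).
rewrite mulrC -ler_pdivlMr//; apply: worst_case_le; first by exists (lambda 1%N w).
move=> l Sl; rewrite ler_pdivlMr// mulrC.
have [l0 l1] := Sl.
pose S i := \sum_(1 <= t < T.+1) gap i t w.
have jensen i : T%:R * client_mean data i (riskf (average_iterate T theta w)) <=
    S i + \sum_(1 <= t < T.+1) riskf (theta t w) (zeta i t w).
  rewrite -big_split/= (eq_bigr (fun t => client_mean data i (riskf (theta t w)))); last first.
    by move=> t _; rewrite /gap subrK.
  rewrite /client_mean exchange_big/= mulr_sumr big_seq [leRHS]big_seq.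
  apply: ler_sum => x xS; rewrite -mulr_sumr mulrCA ler_wpM2l ?empirical_ge0//.
  have := risk_jensen rho_gt0 beta_gt0 L_convex L_differentiable Theta_convex
    (support_Xi xS) (penK xS) T0 (fun t tT => theta_in w (leqT1 tT)).
  by move=> /(ler_wpM2l (ltW T0')); rewrite mulrA divff ?gt_eqF// mul1r.
have amgm i : l 0 i * S i <= r^-1 / 2 * S i ^+ 2 + r / 2.
  have li1 := simplex_le1 i Sl.
  have h1 : l 0 i * S i <= `|S i|.
    apply: (@le_trans _ _ (l 0 i * `|S i|)); first by rewrite ler_wpM2l// ler_norm.
    by rewrite ler_piMl.
  apply: (le_trans h1).
  have -> : r^-1 / 2 * S i ^+ 2 + r / 2 = `|S i| + r^-1 / 2 * (`|S i| - r) ^+ 2.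
    by rewrite sqrrB real_normK ?num_real//; field; rewrite gt_eqF.
  by rewrite lerDl mulr_ge0 ?sqr_ge0// divr_ge0// invr_ge0 ltW.
have regret := pathwise_regret w Tth Sl.
(* Each [lambda t w] is a point of the simplex, so in every round the comparator pays at most its
   own worst case. *)
have worst_bound : \sum_(1 <= t < T.+1) \sum_(i < N)
    lambda t w 0 i * client_mean data i (riskf th) <= T%:R * worst th.
  have -> : T%:R * worst th = \sum_(1 <= t < T.+1) worst th.
    by rewrite sumr_const_nat subn1 mulr_natl.
  apply: ler_sum_nat => t tT; apply: objective_le_worst => //; exact: lambda_in (leqT1 tT).
have noise : \sum_(1 <= t < T.+1) \sum_(i < N)
    lambda t w 0 i * (client_mean data i (riskf th) - riskf th (zeta i t w)) =
    \sum_(1 <= t < T.+1) \sum_(i < N) lambda t w 0 i * client_mean data i (riskf th)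
    - \sum_(1 <= t < T.+1) \sum_(i < N) lambda t w 0 i * riskf th (zeta i t w).
  rewrite -sumrB; apply: eq_bigr => t _; rewrite -sumrB.
  by apply: eq_bigr => i _; rewrite mulrBr.
have split_sum : T%:R * \sum_(i < N) l 0 i * client_mean data i
      (riskf (average_iterate T theta w)) <=
    \sum_(i < N) l 0 i * S i
    + \sum_(1 <= t < T.+1) \sum_(i < N) l 0 i * riskf (theta t w) (zeta i t w).
  rewrite exchange_big/= -big_split/= mulr_sumr; apply: ler_sum => i _.
  by rewrite mulrCA -mulr_sumr -mulrDr ler_wpM2l.
have amgm_sum : \sum_(i < N) l 0 i * S i <=
    \sum_(i < N) (r^-1 / 2 * S i ^+ 2) + N%:R * (r / 2).
  have -> : N%:R * (r / 2) = \sum_(i < N) (r / 2).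
    by rewrite sumr_const card_ord mulr_natl.
  by rewrite -big_split/=; apply: ler_sum => i _; exact: amgm.
rewrite /bound noise; lra.
Qed.

Let mm (A : set Omega) : @measurable _ Omega A -> measurable A. Proof. by []. Qed.

Let bmeasF t (Y : Omega -> R) : bmeas (F t) Y -> bmeas measurable Y.
Proof. by apply: bmeasS => A; exact: Fmeas. Qed.

Let S_bmeas i : bmeas measurable (fun w => \sum_(1 <= t < T.+1) gap i t w).
Proof.
apply: bmeas_sum => t; rewrite mem_index_iota ltnS => tT.
exact: bmeasF (gap_bmeas i tT).
Qed.

Let S2_bmeas (r : R) i : bmeas measurable
  (fun w => r^-1 / 2 * (\sum_(1 <= t < T.+1) gap i t w) ^+ 2).
Proof. exact: bmeasZ (bmeasM (S_bmeas i) (S_bmeas i)). Qed.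

Let comparator_bmeas th t i : (1 <= t <= T)%N -> bmeas measurable
  (fun w => lambda t w 0 i * (client_mean data i (riskf th) - riskf th (zeta i t w))).
Proof.
move=> tT; apply: bmeasM; first exact: bmeasF (lambda_bmeas i tT).
exact: bmeasF (comparator_noise_bmeas th i tT).
Qed.

Let comparator_sum_bmeas th : bmeas measurable
  (fun w => \sum_(1 <= t < T.+1) \sum_(i < N)
        lambda t w 0 i * (client_mean data i (riskf th) - riskf th (zeta i t w))).
Proof.
apply: bmeas_sum => t; rewrite mem_index_iota ltnS => tT.
by apply: bmeas_sum => i _; exact: comparator_bmeas.
Qed.

Let bound_bmeas th r : bmeas measurable (bound th r).
Proof.
apply: bmeasD; first by apply: bmeas_sum => i _; exact: S2_bmeas.
by apply: bmeasD; [exact: bmeasZ|exact: bmeas_cst].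
Qed.

Lemma expected_bound th r : 0 < r ->
  E (bound th r) <= N%:R * (r^-1 / 2 * (T%:R * (Mmean + M) ^+ 2))
    + (N%:R * (r / 2)
       + (Dtheta ^+ 2 / (2 * eta) + T%:R * (eta * Gtheta ^+ 2 / 2))
       + (Dlambda ^+ 2 / (2 * eta) + T%:R * (eta * Glambda ^+ 2 / 2))
       + T%:R * (Merr * eps) + T%:R * worst th).
Proof.
move=> r0; rewrite /E /bound.
rewrite (Rintegral_bmeasD _ mm); last 2 first.
- by apply: bmeas_sum => i _; exact: S2_bmeas.
- by apply: bmeasD; [exact: bmeasZ|exact: bmeas_cst].
rewrite (Rintegral_bmeasD _ mm); [|exact: bmeasZ|exact: bmeas_cst].
rewrite (Rintegral_bmeasZ _ mm)// (Rintegral_bmeas_sum _ mm); last first.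
  by move=> i _; exact: S2_bmeas.
rewrite (Rintegral_bmeas_cst P) (Rintegral_bmeas_sum _ mm); last first.
  move=> t; rewrite mem_index_iota ltnS => tT.
  by apply: bmeas_sum => i _; exact: comparator_bmeas.
(* The weight [lambda t] is known before the draw of round [t], so every summand has mean zero. *)
rewrite [X in -1 * X](_ : _ = 0) ?mulr0 ?add0r; last first.
  rewrite big_nat big1// => t; rewrite ltnS => tT.
  rewrite (Rintegral_bmeas_sum _ mm); last by move=> i _; exact: comparator_bmeas.
  rewrite big1// => i _; exact: comparator_noise_centered (lambda_bmeas i tT).
rewrite lerD2r; have -> : N%:R * (r^-1 / 2 * (T%:R * (Mmean + M) ^+ 2)) =
    \sum_(i < N) (r^-1 / 2 * (T%:R * (Mmean + M) ^+ 2)).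
  by rewrite sumr_const card_ord mulr_natl.
apply: ler_sum => i _; rewrite (Rintegral_bmeasZ _ mm); last first.
  exact: bmeasM (S_bmeas i) (S_bmeas i).
rewrite ler_wpM2l//; first by rewrite divr_ge0// invr_ge0 ltW.
exact: gap_second_moment.
Qed.

Lemma average_in w : (0 < T)%N -> Theta (average_iterate T theta w).
Proof.
by move=> T0; apply: convex_set_average => // t tT; exact: theta_in (leqT1 tT).
Qed.

Lemma expected_worst_le th : (0 < T)%N -> eta = (Num.sqrt T%:R)^-1 -> Theta th ->
  ('E_P[fun w => worst (average_iterate T theta w)] <= (worst th +
     (N%:R * ((Mmean + M) ^+ 2 + 1) / 2 + (Dtheta ^+ 2 + Gtheta ^+ 2) / 2
      + (Dlambda ^+ 2 + Glambda ^+ 2) / 2 + Merr) * (eta + eps))%:E)%E.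
Proof.
move=> T0 etaE Tth; have T0' : 0 < T%:R :> R by rewrite ltr0n.
have r0 : 0 < Num.sqrt T%:R :> R by rewrite sqrtr_gt0.
have lambda1 w := lambda_in w (isT : (1 <= 1 <= T.+1)%N).
pose B w := T%:R^-1 * bound th (Num.sqrt T%:R) w.
have bB : bmeas measurable B by exact: bmeasZ.
(* The expectation is compared with that of the majorant directly, using nonnegativity of the worst
   case in place of its measurability. *)
apply: (@le_trans _ _ (\int[P]_w (B w)%:E)%E).
  rewrite unlock; apply: ge0_le_integral_nonmeasurable => w; rewrite lee_fin.
    by apply: worst_case_ge0; [exists (lambda 1%N w)|exact: average_in].
  by rewrite /B -ler_pdivrMl ?invr_gt0// invrK average_worst_le.
rewrite -(@fineK _ (\int[P]_w (B w)%:E)%E); last first.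
  by rewrite integrable_fin_num//; exact: (bmeas_integrable P mm bB).
rewrite lee_fin -[leLHS]/(\int[P]_w B w) (Rintegral_bmeasZ _ mm)//.
rewrite -ler_pdivlMl ?invr_gt0// invrK.
apply: le_trans (expected_bound _ r0) _; rewrite etaE.
apply: balanced_step_rate => //; rewrite ?sqr_ge0//.
- by rewrite sqr_sqrtr// ltW.
- rewrite mulr_ge0 ?expR_ge0// addr_ge0// !mulr_ge0// ltW//.
  exact: (inv_rho_beta_gt0 rho_gt0 beta_gt0).
Qed.

End run.

Theorem theorem1 (R : realType) (p q N : nat)
    (Theta : set 'rV[R]_p) (Xi : set 'rV[R]_q)
    (L : 'rV[R]_p -> 'rV[R]_q -> R) (c : 'rV[R]_q -> 'rV[R]_q -> R)
    (rho beta : R) (data : 'I_N -> seq 'rV[R]_q)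
    (Dtheta Dlambda B1 B2 Lthetaxi Lxi : R)
    (rho_gt0 : 0 < rho) (beta_gt0 : 0 < beta)
    (data_nonempty : forall i, (0 < size (data i))%N)
    (data_Xi : forall i zeta, zeta \in data i -> Xi zeta)
    (Theta_convex : convex_set Theta) (Xi_convex : convex_set Xi)
    (L_convex : forall xi, Xi xi -> convex_function Theta (fun th => L th xi))
    (L_concave : forall th, Theta th -> concave_function Xi (L th))
    (Theta_bounded : forall th1 th2, Theta th1 -> Theta th2 ->
       norm2 (th1 - th2) <= Dtheta)
    (simplex_bounded : forall l1 l2, simplex R N l1 -> simplex R N l2 ->
       norm2 (l1 - l2) <= Dlambda)
    (L_differentiable : forall th xi, Theta th -> Xi xi ->
       differentiable (fun th' => L th' xi : R^o) th)
    (L_bounded : forall th xi, Theta th -> Xi xi -> `|L th xi| <= B1)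
    (grad_bounded : forall th xi, Theta th -> Xi xi ->
       norm2 (grad (fun th' => L th' xi) th) <= B2)
    (c_strongly_convex : forall zeta, Xi zeta ->
       strongly_convex_function Xi (fun xi => c xi zeta))
    (grad_lipschitz : forall th xi1 xi2, Theta th -> Xi xi1 -> Xi xi2 ->
       norm2 (grad (fun th' => L th' xi1) th - grad (fun th' => L th' xi2) th)
         <= Lthetaxi * norm2 (xi1 - xi2))
    (penalized_differentiable : forall th zeta xi,
       Theta th -> Xi zeta -> Xi xi ->
       differentiable (fun xi' => penalized L c rho th zeta xi' : R^o) xi)
    (penalized_smooth : forall th zeta xi1 xi2,
       Theta th -> Xi zeta -> Xi xi1 -> Xi xi2 ->
       norm2 (grad (penalized L c rho th zeta) xi1
              - grad (penalized L c rho th zeta) xi2)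
         <= Lxi * norm2 (xi1 - xi2)) :
  exists C : R,
    forall (T : nat) (eps : R), (0 < T)%N -> 0 <= eps ->
    forall (d : measure_display) (Omega : measurableType d)
      (P : probability Omega R) (F : nat -> set (set Omega))
      (theta : nat -> Omega -> 'rV[R]_p) (lambda : nat -> Omega -> 'rV[R]_N)
      (zeta z : 'I_N -> nat -> Omega -> 'rV[R]_q),
    dorfl_run Theta Xi L c rho beta data T eps
      (Num.sqrt T%:R)^-1 (Num.sqrt T%:R)^-1 P F theta lambda zeta z ->
    (`| 'E_P[fun w =>
          worst_case Xi L c rho beta data (average_iterate T theta w)]
        - (inf [set worst_case Xi L c rho beta data th | th in Theta])%:E |
     <= (C * ((Num.sqrt T%:R)^-1 + eps))%:E)%E.

Proof.
have [K K0 KP] := uniform_data_bounds rho_gt0 data_Xi L_concave L_bounded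
  c_strongly_convex penalized_differentiable penalized_smooth.
(* The constant stays open until the end, where [expected_worst_le] supplies it; it is made of [N],
   the data, the diameters and [K], and involves neither [T], [eps] nor the probability space. *)
eexists => T eps T0 eps0 d Omega P F theta lambda zeta z hrun.
set eta := (Num.sqrt T%:R)^-1 in hrun *.
have eta0 : 0 < eta by rewrite invr_gt0 sqrtr_gt0 ltr0n.
pose w0 : Omega := point.
have simplex_n0 : exists l, simplex R N l.
  by exists (lambda 1%N w0); exact: (run_init hrun w0).2.
have Theta1 : Theta (theta 1%N w0) by exact: (run_init hrun w0).1.
pose W := [set worst_case Xi L c rho beta data th | th in Theta].
have W_n0 : W !=set0 by exists (worst_case Xi L c rho beta data (theta 1%N w0)), (theta 1%N w0).
have worst_ge0 th : Theta th -> 0 <= worst_case Xi L c rho beta data th.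
  exact: (worst_case_ge0 rho_gt0 beta_gt0 data_Xi KP).
have W_lb : has_inf W by split=> //; exists 0 => _ [th Tth <-]; exact: worst_ge0.
have infW0 : 0 <= inf W by apply: lb_le_inf => // _ [th Tth <-]; exact: worst_ge0.
have upper := fun th => expected_worst_le rho_gt0 beta_gt0 data_Xi Theta_convex L_convex
  Theta_bounded simplex_bounded L_differentiable grad_bounded K0 KP
  eps0 eta0 hrun (th := th) T0 erefl.
have lower : ((inf W)%:E <= 'E_P[fun w =>
    worst_case Xi L c rho beta data (average_iterate T theta w)])%E.
  rewrite -(expectation_cst P) unlock; apply: ge0_le_integral_nonmeasurable => w.
    by rewrite lee_fin.
  rewrite lee_fin; apply: ge_inf; first exact: W_lb.2.
  exists (average_iterate T theta w) => //.
  exact: (average_in Theta_convex hrun).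
rewrite -/W; set Ew := expectation _ _ in upper lower *.
(* Finiteness is read off the two bounds, the upper one at the initial iterate. *)
have Ew_fin : Ew \is a fin_num.
  rewrite fin_numE -ltNye -ltey; apply/andP; split.
    exact: lt_le_trans (ltNyr _) lower.
  exact: le_lt_trans (upper _ Theta1) (ltry _).
rewrite -(fineK Ew_fin) in upper lower *; rewrite -EFinB abse_EFin lee_fin.
rewrite lee_fin in lower.
rewrite ger0_norm ?subr_ge0// lerBlDl -lerBlDr; apply: lb_le_inf => // _ [th Tth <-].
by rewrite lerBlDr; have := upper th Tth; rewrite lee_fin; exact.
Qed.
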